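(* Let $G$ be a finite group, let $U$ be a projective unitary representation of $G$ on a finite-dimensional Hilbert space $\mathcal{H}$, let $H$ be a $G$-invariant Hamiltonian on $\mathcal{H}$ (i.e. $[U(g),H]=0$ for all $g\in G$), and let $\rho$ be a state on $\mathcal{H}$. Then $\rho$ is completely passive under $G$-invariant unitaries if and only if it is completely passive, i.e. it is a ground state or a Gibbs state $e^{-\beta H}/\mathrm{tr}(e^{-\beta H})$ with inverse temperature $\beta\in[0,\infty)$.
   Context: Let $H^{\times n}:=\sum_{j=1}^nI^{\otimes j-1}\otimes H\otimes I^{\otimes n-j}$. Define $W^{(n)}(\rho):=\max_V\{\mathrm{tr}(\rho^{\otimes n}H^{\times n})-\mathrm{tr}(V\rho^{\otimes n}V^\dagger H^{\times n})\}$, the maximum being over all unitaries $V$ on $\mathcal{H}^{\otimes n}$, and $W^{(n)}_{G\text{-}\mathrm{inv}}(\rho)$ by the same formula with the maximum restricted to unitaries satisfying $[V,U(g)^{\otimes n}]=0$ for all $g\in G$. The state $\rho$ is completely passive if $W^{(n)}(\rho)=0$ for all $n\in\mathbb{N}$, and completely passive under $G$-invariant unitaries if $W^{(n)}_{G\text{-}\mathrm{inv}}(\rho)=0$ for all $n\in\mathbb{N}$. A ground state is any (possibly mixed) state supported on the eigenspace of $H$ with the smallest eigenvalue, which may be degenerate. *)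

(* Defs.v *)
From HB Require Import structures.
From mathcomp Require Import all_boot all_order all_algebra all_fingroup.
From mathcomp Require Import all_classical all_reals all_analysis.
From mathcomp Require Import complex mxtens.

Set Implicit Arguments.
Unset Strict Implicit.
Unset Printing Implicit Defensive.

Import Order.TTheory GRing.Theory Num.Theory numFieldNormedType.Exports.

Local Open Scope classical_set_scope.
Local Open Scope complex_scope.
Local Open Scope ring_scope.

(* The Hilbert space is R[i]^d with its standard inner product.  Kets are
   column vectors, and operators act on them from the left. *)

Definition adjmx (R : realType) (m n : nat) (A : 'M[R[i]]_(m, n)) :
    'M[R[i]]_(n, m) :=
  map_mx Num.conj A^T.

Definition is_hermitian (R : realType) (d : nat) (A : 'M[R[i]]_d) : Prop :=
  adjmx A = A.

(* In R[i], [0 <= z] means that z is real and nonnegative. *)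
Definition is_psd (R : realType) (d : nat) (A : 'M[R[i]]_d) : Prop :=
  forall v : 'cV[R[i]]_d, 0 <= (adjmx v *m A *m v) 0 0.

(* The trace condition excludes d = 0. *)
Definition is_state (R : realType) (d : nat) (rho : 'M[R[i]]_d) : Prop :=
  [/\ is_hermitian rho, is_psd rho & \tr rho = 1].

Definition is_projective_unitary_repr (R : realType) (gT : finGroupType)
    (G : {group gT}) (d : nat) (U : gT -> 'M[R[i]]_d) : Prop :=
  (forall g, g \in G -> U g \is unitarymx) /\
  exists omega : gT -> gT -> R[i], forall g h, g \in G -> h \in G ->
    `|omega g h| = 1 /\ U g *m U h = omega g h *: U (g * h)%g.

Lemma tens_site_dim (d n : nat) (j : 'I_n) :
  (d ^ j * d * d ^ (n - j.+1) = d ^ n)%N.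
Proof. by rewrite -expnSr -expnD subnKC. Qed.

(* The index j is counted from 0, so the j-th summand has j identity factors
   to the left of H and n - j - 1 to its right. *)
Definition total_hamiltonian (R : realType) (d : nat) (H : 'M[R[i]]_d)
    (n : nat) : 'M[R[i]]_(d ^ n) :=
  \sum_(j < n) castmx (tens_site_dim d j, tens_site_dim d j)
    (ntensmx (1%:M : 'M[R[i]]_d) j *t H *t
     ntensmx (1%:M : 'M[R[i]]_d) (n - j.+1)).

Definition extracted_work (R : realType) (d : nat) (H rho : 'M[R[i]]_d)
    (n : nat) (V : 'M[R[i]]_(d ^ n)) : R[i] :=
  \tr (ntensmx rho n *m total_hamiltonian H n) -
  \tr (V *m ntensmx rho n *m adjmx V *m total_hamiltonian H n).

Definition is_max (R : realType) (A : set R[i]) (w : R[i]) : Prop :=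
  A w /\ ubound A w.

(* [is_max_work H rho n w] says that the maximum W^(n)(rho) is attained and
   equals w.  All extracted works of a Hermitian rho and H are real, so the
   partial order of R[i] restricts to the usual order on them. *)
Definition is_max_work (R : realType) (d : nat) (H rho : 'M[R[i]]_d)
    (n : nat) (w : R[i]) : Prop :=
  is_max [set extracted_work H rho V | V in
           [set V : 'M[R[i]]_(d ^ n) | V \is unitarymx]] w.

Definition is_max_work_inv (R : realType) (gT : finGroupType)
    (G : {group gT}) (d : nat) (U : gT -> 'M[R[i]]_d) (H rho : 'M[R[i]]_d)
    (n : nat) (w : R[i]) : Prop :=
  is_max [set extracted_work H rho V | V in
           [set V : 'M[R[i]]_(d ^ n) | V \is unitarymx /\
             forall g, g \in G -> comm_mx V (ntensmx (U g) n)]] w.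

Definition completely_passive (R : realType) (d : nat)
    (H rho : 'M[R[i]]_d) : Prop :=
  forall n : nat, (0 < n)%N -> is_max_work H rho n 0.

Definition completely_passive_inv (R : realType) (gT : finGroupType)
    (G : {group gT}) (d : nat) (U : gT -> 'M[R[i]]_d)
    (H rho : 'M[R[i]]_d) : Prop :=
  forall n : nat, (0 < n)%N -> is_max_work_inv G U H rho n 0.

(* [eigenspace] and [<=]%MS concern row vectors: for Hermitian rho and H, the
   row space of rho consists of the bras of the vectors in the support of rho,
   and [eigenspace H e] of the bras of the e-eigenvectors of H. *)
Definition is_ground_state (R : realType) (d : nat)
    (H rho : 'M[R[i]]_d) : Prop :=
  is_state rho /\
  exists e : R[i], [/\ eigenvalue H e,
    forall e', eigenvalue H e' -> e <= e' & (rho <= eigenspace H e)%MS].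

Definition expmx (K : numFieldType) (d : nat) (A : 'M[K]_d) : 'M[K]_d :=
  limn (series (fun k : nat => k`!%:R^-1 *: A ^+ k)).

Definition gibbs_state (R : realType) (d : nat) (H : 'M[R[i]]_d)
    (beta : R) : 'M[R[i]]_d :=
  (\tr (expmx ((- beta)%:C *: H)))^-1 *: expmx ((- beta)%:C *: H).

(* Main.v *)
(* Rescale U to unit determinants: on tensor powers of exponent divisible by a
   suitable K it is then a genuine representation, whose invariant vectors are
   the twirls sum_g u_g^(x)n x.  The reflection along an invariant vector is a
   G-invariant unitary, so passivity orders the weights of rho^(x)n on twirled
   energy eigenvectors and kills the coherences between different energies.

   Twirling costs only a bounded factor: the squared norm of the twirl of x^(x)n
   is a power sum of numbers equal to 1 or of modulus < 1.  Hence, taking n to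
   infinity, ordering the twirled vectors gives the classical ordering of
   products of eigenvalues of rho, up to replacing a vector by some element of
   its G-orbit.  This forces the largest eigenvalue t(E) of rho in the energy
   level E to be c exp(-beta E), unless rho is a ground state; and every vector
   of a level has an element of its orbit attaining t(E), so the level is a
   finite union of kernels of t(E) - rho pulled back along G, hence one of them.

   Coherences vanish because the power sums of the numbers <u_g a|rho|u_h b>^K
   vanish for all exponents. *)

Require Import Defs.
From HB Require Import structures.
From mathcomp Require Import all_boot all_order all_algebra all_fingroup.
From mathcomp Require Import all_classical all_reals all_analysis.
From mathcomp Require Import complex mxtens.
From mathcomp Require Import ring lra.

Set Implicit Arguments.
Unset Strict Implicit.
Unset Printing Implicit Defensive.

Import Order.TTheory GRing.Theory Num.Theory.

Local Open Scope complex_scope.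
Local Open Scope ring_scope.

(** * Adjoints and the inner product *)

Section Adjoint.

Variable R : realType.
Local Notation C := R[i].

Lemma adjmxE m n (A : 'M[C]_(m, n)) i j : adjmx A i j = (A j i)^* .
Proof. by rewrite !mxE. Qed.

Lemma adjmxK m n (A : 'M[C]_(m, n)) : adjmx (adjmx A) = A.
Proof. exact: trmxCK. Qed.

Lemma adjmxM m n p (A : 'M[C]_(m, n)) (B : 'M[C]_(n, p)) :
  adjmx (A *m B) = adjmx B *m adjmx A.
Proof. by rewrite /adjmx trmx_mul map_mxM. Qed.

Lemma adjmxD m n (A B : 'M[C]_(m, n)) : adjmx (A + B) = adjmx A + adjmx B.
Proof. by rewrite /adjmx linearD map_mxD. Qed.

Lemma adjmxN m n (A : 'M[C]_(m, n)) : adjmx (- A) = - adjmx A.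
Proof. by rewrite /adjmx linearN map_mxN. Qed.

Lemma adjmxZ m n (c : C) (A : 'M[C]_(m, n)) : adjmx (c *: A) = c^* *: adjmx A.
Proof. by rewrite /adjmx linearZ /= map_mxZ. Qed.

Lemma adjmx0 m n : adjmx (0 : 'M[C]_(m, n)) = 0.
Proof. by rewrite /adjmx trmx0 map_mx0. Qed.

Lemma adjmx1 n : adjmx (1%:M : 'M[C]_n) = 1%:M.
Proof. by rewrite /adjmx trmx1 map_mx1. Qed.

Lemma adjmx_sum m n I (r : seq I) (P : pred I) (F : I -> 'M[C]_(m, n)) :
  adjmx (\sum_(i <- r | P i) F i) = \sum_(i <- r | P i) adjmx (F i).
Proof. by rewrite /adjmx linear_sum raddf_sum. Qed.

Lemma unitarymxE n (V : 'M[C]_n) : V \is unitarymx -> V *m adjmx V = 1%:M.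
Proof. by move/unitarymxP. Qed.

Lemma unitarymxEl n (V : 'M[C]_n) : V \is unitarymx -> adjmx V *m V = 1%:M.
Proof. by move/unitarymxE/mulmx1C. Qed.

Definition dot n (u v : 'cV[C]_n) : C := (adjmx u *m v) 0 0.

Lemma dotE n (u v : 'cV[C]_n) : dot u v = \sum_i (u i 0)^* * v i 0.
Proof. by rewrite /dot mxE; apply: eq_bigr => i _; rewrite adjmxE. Qed.

Lemma dotDl n (u u' v : 'cV[C]_n) : dot (u + u') v = dot u v + dot u' v.
Proof. by rewrite /dot adjmxD mulmxDl mxE. Qed.

Lemma dotDr n (u v v' : 'cV[C]_n) : dot u (v + v') = dot u v + dot u v'.
Proof. by rewrite /dot mulmxDr mxE. Qed.

Lemma dotZl n c (u v : 'cV[C]_n) : dot (c *: u) v = c^* * dot u v.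
Proof. by rewrite /dot adjmxZ -scalemxAl mxE. Qed.

Lemma dotZr n c (u v : 'cV[C]_n) : dot u (c *: v) = c * dot u v.
Proof. by rewrite /dot -scalemxAr mxE. Qed.

Lemma dotNl n (u v : 'cV[C]_n) : dot (- u) v = - dot u v.
Proof. by rewrite -scaleN1r dotZl rmorphN1 mulN1r. Qed.

Lemma dotNr n (u v : 'cV[C]_n) : dot u (- v) = - dot u v.
Proof. by rewrite -scaleN1r dotZr mulN1r. Qed.

Lemma dot0l n (u : 'cV[C]_n) : dot 0 u = 0.
Proof. by rewrite /dot adjmx0 mul0mx mxE. Qed.

Lemma dot0r n (u : 'cV[C]_n) : dot u 0 = 0.
Proof. by rewrite /dot mulmx0 mxE. Qed.

Lemma dot_suml n I (r : seq I) (P : pred I) (F : I -> 'cV[C]_n) v :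
  dot (\sum_(i <- r | P i) F i) v = \sum_(i <- r | P i) dot (F i) v.
Proof. by rewrite /dot adjmx_sum mulmx_suml summxE. Qed.

Lemma dot_sumr n I (r : seq I) (P : pred I) (F : I -> 'cV[C]_n) v :
  dot v (\sum_(i <- r | P i) F i) = \sum_(i <- r | P i) dot v (F i).
Proof. by rewrite /dot mulmx_sumr summxE. Qed.

Lemma dot_combination n (a b c e : 'cV[C]_n) (z w : C) :
  dot (a + z *: b) (c + w *: e) =
  dot a c + w * dot a e + z^* * (dot b c + w * dot b e).
Proof. by rewrite dotDl dotZl (dotDr a) (dotDr b) !dotZr. Qed.

Lemma dotC n (u v : 'cV[C]_n) : (dot u v)^* = dot v u.
Proof.
by rewrite !dotE rmorph_sum; apply: eq_bigr => i _; rewrite rmorphM /= conjCK mulrC.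
Qed.

Lemma dotMr n m (u : 'cV[C]_n) (A : 'M[C]_(n, m)) v :
  dot u (A *m v) = dot (adjmx A *m u) v.
Proof. by rewrite /dot adjmxM adjmxK mulmxA. Qed.

Lemma dotMl n m (u : 'cV[C]_n) (A : 'M[C]_(m, n)) v :
  dot (A *m u) v = dot u (adjmx A *m v).
Proof. by rewrite dotMr adjmxK. Qed.

Lemma dot_unitary n (V : 'M[C]_n) (u v : 'cV[C]_n) :
  V \is unitarymx -> dot (V *m u) (V *m v) = dot u v.
Proof. by move=> Vu; rewrite dotMl mulmxA unitarymxEl // mul1mx. Qed.

Lemma dot_ge0 n (u : 'cV[C]_n) : 0 <= dot u u.
Proof.
by rewrite dotE sumr_ge0 // => i _; rewrite mulrC mul_conjC_ge0.
Qed.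

Lemma dot_eq0 n (u : 'cV[C]_n) : (dot u u == 0) = (u == 0).
Proof.
apply/eqP/eqP => [|->]; last by rewrite dot0l.
rewrite dotE => /eqP; rewrite psumr_eq0 => [/allP u0|i _]; last first.
  by rewrite mulrC mul_conjC_ge0.
apply/matrixP => i j; rewrite ord1 mxE; have := u0 i (mem_index_enum _).
by rewrite mulrC mul_conjC_eq0 => /eqP.
Qed.

Lemma dot_gt0 n (u : 'cV[C]_n) : (0 < dot u u) = (u != 0).
Proof. by rewrite lt0r dot_ge0 dot_eq0 andbT. Qed.

Lemma matrix_dotE n (A : 'M[C]_n) (u v : 'cV[C]_n) :
  (adjmx u *m A *m v) 0 0 = dot u (A *m v).
Proof. by rewrite /dot mulmxA. Qed.

Lemma hermitian_dot n (A : 'M[C]_n) (u v : 'cV[C]_n) :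
  is_hermitian A -> dot (A *m u) v = dot u (A *m v).
Proof. by move=> Ah; rewrite dotMl Ah. Qed.

Lemma psd_dot_ge0 n (A : 'M[C]_n) u : is_psd A -> 0 <= dot u (A *m u).
Proof. by move=> Ap; rewrite -matrix_dotE; exact: Ap. Qed.

(* Expand the form at [w - <y|w> y]. *)
Lemma psd_eigen_le n (A : 'M[C]_n) p (y w : 'cV[C]_n) :
  is_hermitian A -> is_psd A -> dot y y = 1 -> A *m y = p *: y ->
  p * `|dot y w| ^+ 2 <= dot w (A *m w).
Proof.
move=> Ah Ap y1 Ay; rewrite -subr_ge0.
have := psd_dot_ge0 (w - dot y w *: y) Ap.
rewrite mulmxBr -scalemxAr Ay dotDl dotNl dotZl !dotDr !dotNr !dotZr y1.
have -> : dot y (A *m w) = p^* * dot y w.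
  by rewrite -hermitian_dot // Ay dotZl.
have p_real : p^* = p.
  have : dot (A *m y) y = dot y (A *m y) by exact: hermitian_dot.
  by rewrite Ay dotZl dotZr y1 !mulr1.
rewrite p_real normCK (dotC y w) => h; apply: le_trans h _.
by rewrite le_eqVlt; apply/orP; left; apply/eqP; ring.
Qed.

(** The form is nonnegative at every difference [v i - v j]; summed over all pairs it expands to
    twice the right side minus the left side. *)
Lemma psd_sum_le n (A : 'M[C]_n) (I : finType) (P : pred I) (v : I -> 'cV[C]_n) :
  is_hermitian A -> is_psd A ->
  dot (\sum_(i | P i) v i) (A *m \sum_(i | P i) v i) <=
  #|P|%:R * \sum_(i | P i) dot (v i) (A *m v i).
Proof.
move=> Ah Ap.
have : 0 <= \sum_(i | P i) \sum_(j | P j) dot (v i - v j) (A *m (v i - v j)).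
  by do 2!(apply: sumr_ge0 => ? _); exact: psd_dot_ge0.
set Q := dot (\sum_(i | P i) v i) _.
set S := \sum_(i | P i) dot _ _ => h.
suff E : \sum_(i | P i) \sum_(j | P j) dot (v i - v j) (A *m (v i - v j)) =
    2 * (#|P|%:R * S - Q).
  by move: h; rewrite E pmulr_rge0 ?subr_ge0 // ltr0n.
have QE : Q = \sum_(i | P i) \sum_(j | P j) dot (v i) (A *m v j).
  rewrite /Q dot_suml; apply: eq_bigr => i _.
  by rewrite mulmx_sumr dot_sumr.
have QE' : Q = \sum_(i | P i) \sum_(j | P j) dot (v j) (A *m v i).
  by rewrite QE exchange_big.
have SE : #|P|%:R * S = \sum_(i | P i) \sum_(j | P j) dot (v i) (A *m v i).
  rewrite mulr_sumr; apply: eq_bigr => i _.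
  by rewrite sumr_const mulr_natl.
have SE' : #|P|%:R * S = \sum_(i | P i) \sum_(j | P j) dot (v j) (A *m v j).
  by rewrite SE exchange_big.
have -> : 2 * (#|P|%:R * S - Q) = (#|P|%:R * S - Q) + (#|P|%:R * S - Q) by ring.
rewrite {1}SE {1}QE {1}SE' {1}QE' -!sumrB -!big_split; apply: eq_bigr => i _.
rewrite -!sumrB -!big_split; apply: eq_bigr => j _ /=.
rewrite mulmxBr -(scaleN1r (v j)) -(scaleN1r (A *m v j)) dot_combination.
rewrite rmorphN1; move: (dot _ _) (dot _ _) (dot _ _) (dot _ _) => a b c e; ring.
Qed.

End Adjoint.

(** * Tensor powers in coordinates *)

Section Digits.

Variable d' : nat.
Local Notation d := d'.+1.

(* The tensor factors are read off from the base-d expansion of an index of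
   the n-fold tensor power, the leftmost factor being the leading digit. *)
Definition dig (n k i : nat) : 'I_d :=
  Ordinal (ltn_pmod (i %/ d ^ (n - k.+1)) (ltn0Sn d')).

(** Division by [d ^ m] drops the last m digits; reduction modulo [d ^ n], in the next lemma, keeps
    the last n. These match the index arithmetic of Kronecker products. *)
Lemma dig_divn n m k i :
  (k < n)%N -> dig n k (i %/ d ^ m) = dig (n + m) k i.
Proof.
move=> kn; apply: val_inj => /=.
by rewrite -divnMA -expnD addnC -addnBAC.
Qed.

Lemma dig_modn n m k i : (k < n)%N ->
  dig n k (i %% d ^ n) = dig (m + n) (m + k) i.
Proof.
move=> kn; apply: val_inj => /=; rewrite -addnS subnDl.
set e := (n - k.+1)%N.
have -> : (d ^ n = d ^ k * d * d ^ e)%N by rewrite -expnSr -expnD subnKC.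
rewrite [in RHS](divn_eq i (d ^ k * d * d ^ e)) mulnA divnMDl ?expn_gt0 //.
by rewrite mulnA modnMDl.
Qed.

Lemma dig_inj n i j : (i < d ^ n)%N -> (j < d ^ n)%N ->
  (forall k, (k < n)%N -> dig n k i = dig n k j) -> i = j.
Proof.
elim: n i j => [|n IH] i j; first by rewrite !ltnS !leqn0 => /eqP-> /eqP->.
move=> ilt jlt ij; rewrite (divn_eq i (d ^ n)) (divn_eq j (d ^ n)).
congr (_ * _ + _)%N.
  have := congr1 val (ij 0%N (ltn0Sn n)); rewrite /= subn1 /= !modn_small //.
  - by rewrite ltn_divLR ?expn_gt0 // -expnS.
  - by rewrite ltn_divLR ?expn_gt0 // -expnS.
apply: IH; rewrite ?ltn_pmod ?expn_gt0 // => k kn.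
by rewrite !(@dig_modn n 1) // ij.
Qed.

Definition digits n (i : 'I_(d ^ n)) : {ffun 'I_n -> 'I_d} :=
  [ffun k : 'I_n => dig n k i].

Lemma digits_bij n : bijective (@digits n).
Proof.
apply: inj_card_bij; last by rewrite card_ffun !card_ord.
move=> i j /ffunP ij; apply: val_inj; apply: (@dig_inj n) => [||k kn]; try exact: ltn_ord.
by have := ij (Ordinal kn); rewrite !ffunE.
Qed.

(** An index of the n-fold power is a free choice of n digits, so the sum factorizes by
    distributivity. The product rules for [tensf] and [tensv] come from this. *)
Lemma sum_prod_dig (K : comPzSemiRingType) n (F : nat -> 'I_d -> K) :
  \sum_(i < d ^ n) \prod_(k < n) F k (dig n k i) =
  \prod_(k < n) \sum_(j < d) F k j.
Proof.
rewrite bigA_distr_bigA (reindex (@digits n)) /=; last first.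
  exact/onW_bij/digits_bij.
by apply: eq_bigr => i _; apply: eq_bigr => k _; rewrite ffunE.
Qed.

End Digits.

(** * Product operators, product vectors and the total Hamiltonian *)

Section Tensor.

Variables (R : realType) (d' : nat).
Local Notation d := d'.+1.
Local Notation C := R[i].

(** The factors may vary with the site: a term of the total Hamiltonian has [H] at one site only,
    and the product vectors used later mix several energy levels. *)
Definition tensf (A : nat -> 'M[C]_d) n : 'M[C]_(d ^ n) :=
  \matrix_(i, j) \prod_(k < n) A k (dig d' n k i) (dig d' n k j).

Definition tensv (x : nat -> 'cV[C]_d) n : 'cV[C]_(d ^ n) :=
  \col_i \prod_(k < n) x k (dig d' n k i) 0.

Lemma eq_tensf A B n :
  (forall k, (k < n)%N -> A k = B k) -> tensf A n = tensf B n.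
Proof.
by move=> AB; apply/matrixP => i j; rewrite !mxE; apply: eq_bigr => k _; rewrite AB.
Qed.

Lemma eq_tensv x y n :
  (forall k, (k < n)%N -> x k = y k) -> tensv x n = tensv y n.
Proof.
by move=> xy; apply/matrixP => i j; rewrite !mxE; apply: eq_bigr => k _; rewrite xy.
Qed.

Lemma tensfM A B n : tensf A n *m tensf B n = tensf (fun k => A k *m B k) n.
Proof.
apply/matrixP => i j; rewrite !mxE.
under eq_bigr do rewrite !mxE -big_split /=.
under [in RHS]eq_bigr do rewrite mxE.
by rewrite (sum_prod_dig n
  (fun k l => A k (dig d' n k i) l * B k l (dig d' n k j))).
Qed.

Lemma tensfMv A x n : tensf A n *m tensv x n = tensv (fun k => A k *m x k) n.
Proof.
apply/matrixP => i j; rewrite !mxE.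
under eq_bigr do rewrite !mxE -big_split /=.
under [in RHS]eq_bigr do rewrite mxE.
by rewrite (sum_prod_dig n (fun k l => A k (dig d' n k i) l * x k l 0)).
Qed.

Lemma dot_tensv x y n :
  dot (tensv x n) (tensv y n) = \prod_(k < n) dot (x k) (y k).
Proof.
rewrite dotE; under eq_bigr do rewrite !mxE rmorph_prod -big_split /=.
under [RHS]eq_bigr do rewrite dotE.
by rewrite (sum_prod_dig n (fun k l => (x k l 0)^* * y k l 0)).
Qed.

Lemma adjmx_tensf A n : adjmx (tensf A n) = tensf (fun k => adjmx (A k)) n.
Proof.
apply/matrixP => i j; rewrite !mxE rmorph_prod; apply: eq_bigr => k _.
by rewrite !mxE.
Qed.

Lemma tensvZ c x n : tensv (fun k => c k *: x k) n =
  (\prod_(k < n) c k) *: tensv x n.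
Proof.
apply/matrixP => i j; rewrite !mxE -big_split; apply: eq_bigr => k _.
by rewrite mxE.
Qed.

Lemma tensvZ1 j c x n : (j < n)%N ->
  tensv (fun k => (if k == j then c else 1) *: x k) n = c *: tensv x n.
Proof.
move=> jn; rewrite tensvZ; congr (_ *: _); rewrite (bigD1 (Ordinal jn)) //= eqxx.
by rewrite big1 ?mulr1 // => k; rewrite -val_eqE /= => /negPf ->.
Qed.

Lemma tensf1 n : tensf (fun=> 1%:M) n = 1%:M.
Proof.
apply/matrixP => i j; rewrite !mxE; have [->|ij] := eqVneq i j.
  by rewrite big1 // => k _; rewrite mxE eqxx.
(* Distinct indices differ in some digit, and the factor at that site vanishes. *)
case: (pickP (fun k : 'I_n => dig d' n k i != dig d' n k j)) => [k kij|same].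
  by rewrite (bigD1 k) //= mxE (negPf kij) mul0r.
case/eqP: ij; apply: val_inj; apply: (@dig_inj d' n) => [||k kn]; try exact: ltn_ord.
by have /negbFE/eqP := same (Ordinal kn).
Qed.

Lemma ntensmxE (A : 'M[C]_d) n : ntensmx A n = tensf (fun=> A) n.
Proof.
case: n => [|n]; first by apply/matrixP => i j; rewrite !ord1 !mxE big_ord0.
elim: n => [|n IH].
  apply/matrixP => i j; rewrite mxE big_ord_recl big_ord0 mulr1.
  by congr (A _ _); apply: val_inj; rewrite /= divn1 modn_small.
rewrite ntensmxSS; apply/matrixP => i j; rewrite !mxE big_ord_recl; congr (_ * _).
  by congr (A _ _); apply: val_inj; rewrite /= subn1 modn_small // ltn_divLR
    ?expn_gt0 // -expnS.
rewrite IH mxE; apply: eq_bigr => k _.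
by congr (A _ _); rewrite (@dig_modn d' n.+1 1).
Qed.

Lemma ntensmxM (A B : 'M[C]_d) n :
  ntensmx (A *m B) n = ntensmx A n *m ntensmx B n.
Proof. by rewrite !ntensmxE tensfM. Qed.

Lemma ntensmx1mx n : ntensmx (1%:M : 'M[C]_d) n = 1%:M.
Proof. by rewrite ntensmxE tensf1. Qed.

Lemma adjmx_ntensmx (A : 'M[C]_d) n : adjmx (ntensmx A n) = ntensmx (adjmx A) n.
Proof. by rewrite !ntensmxE adjmx_tensf. Qed.

Lemma ntensmxMv (A : 'M[C]_d) x n :
  ntensmx A n *m tensv x n = tensv (fun k => A *m x k) n.
Proof. by rewrite ntensmxE tensfMv. Qed.

Lemma ntensmxZ c (A : 'M[C]_d) n : ntensmx (c *: A) n = c ^+ n *: ntensmx A n.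
Proof.
rewrite !ntensmxE; apply/matrixP => i j; rewrite !mxE.
under eq_bigr do rewrite mxE.
by rewrite big_split /= prodr_const card_ord.
Qed.

Lemma ntensmx_unitary (V : 'M[C]_d) n :
  V \is unitarymx -> ntensmx V n \is unitarymx.
Proof.
move=> Vu; apply/unitarymxP; rewrite -[X in _ *m X]/(adjmx _).
by rewrite adjmx_ntensmx -ntensmxM unitarymxE // ntensmx1mx.
Qed.

Lemma ntensmx_hermitian (A : 'M[C]_d) n :
  is_hermitian A -> is_hermitian (ntensmx A n).
Proof. by move=> Ah; rewrite /is_hermitian adjmx_ntensmx Ah. Qed.

Lemma total_hamiltonianE (H : 'M[C]_d) n :
  total_hamiltonian H n =
  \sum_(j < n) tensf (fun k => if k == j then H else 1%:M) n.
Proof.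
apply: eq_bigr => j _; apply/matrixP => i l; rewrite castmxE !mxE /=.
set F := fun k => if k == j :> nat then H else 1%:M.
have jn : (j < n)%N by [].
set m := (n - j.+1)%N; have nE : (j.+1 + m)%N = n by rewrite subnKC.
pose P k := F k (dig d' n k i) (dig d' n k l).
have -> : \prod_(k < n) F k (dig d' n k i) (dig d' n k l) =
    \prod_(0 <= k < n) P k by rewrite big_mkord.
(* Cut the product over the sites at j, to match the three Kronecker factors of the j-th summand. *)
rewrite (@big_cat_nat _ _ _ j) //= 1?ltnW // (big_ltn jn) mulrA.
congr (_ * _ * _).
- rewrite ntensmxE mxE big_mkord; apply: eq_bigr => k _.
  have D (a : nat) : dig d' j k (a %/ d ^ m %/ d) = dig d' n k a.
    by rewrite -divnMA -expnSr dig_divn // addnS -addSn nE.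
  by rewrite /P /F (ltn_eqF (ltn_ord k)) -(D i) -(D l).
- rewrite /P /F eqxx; congr (H _ _); apply: val_inj => /=; congr (_ %% _)%N.
- rewrite ntensmxE mxE -{1}[j.+1]add0n big_addn big_mkord -/m.
  apply: eq_bigr => k _; rewrite /P /F addnC.
  rewrite [X in (if X then _ else _)](_ : _ = false); last first.
    by apply/negbTE; rewrite gtn_eqF // addSn ltnS leq_addr.
  have D (a : nat) : dig d' m k (a %% d ^ m) = dig d' n (j.+1 + k) a.
    by rewrite (@dig_modn d' m j.+1) // nE.
  by rewrite -(D i) -(D l).
Qed.

Lemma total_hamiltonian_hermitian (H : 'M[C]_d) n :
  is_hermitian H -> is_hermitian (total_hamiltonian H n).
Proof.
move=> Hh; rewrite /is_hermitian total_hamiltonianE adjmx_sum.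
apply: eq_bigr => j _; rewrite adjmx_tensf; apply: eq_tensf => k _.
by case: ifP; rewrite ?adjmx1.
Qed.

Lemma total_hamiltonian_eigen (H : 'M[C]_d) n (x : nat -> 'cV[C]_d) e :
  (forall k, (k < n)%N -> H *m x k = e k *: x k) ->
  total_hamiltonian H n *m tensv x n = (\sum_(k < n) e k) *: tensv x n.
Proof.
move=> Hx; rewrite total_hamiltonianE mulmx_suml scaler_suml.
apply: eq_bigr => j _; rewrite tensfMv -(@tensvZ1 j) //.
apply: eq_tensv => k kn; case: ifP => [/eqP->|_]; first exact: Hx.
by rewrite mul1mx scale1r.
Qed.

Lemma total_hamiltonian_comm (H V : 'M[C]_d) n : comm_mx V H ->
  comm_mx (ntensmx V n) (total_hamiltonian H n).
Proof.
move=> VH; rewrite total_hamiltonianE; apply: comm_mx_sum => j _.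
rewrite ntensmxE /comm_mx !tensfM; apply: eq_tensf => k _.
by case: ifP => // _; rewrite mulmx1 mul1mx.
Qed.

End Tensor.

(** * Spectral decompositions *)

(** By cyclicity of the trace, a common change of basis of state and Hamiltonian is absorbed into
    the unitary. *)
Lemma mxtrace_conj (K : comPzRingType) n (V V' Q Q' P E : 'M[K]_n) :
  \tr (V *m (Q *m P *m Q') *m V' *m (Q *m E *m Q')) =
  \tr (Q' *m V *m Q *m P *m (Q' *m V' *m Q) *m E).
Proof. by rewrite -!mulmxA [RHS]mxtrace_mulC !mulmxA. Qed.

Section Spectral.

Variable R : realType.
Local Notation C := R[i].

(** For unitary [Q] the columns of [Q] are eigenvectors with real eigenvalues [h]. With [Q] fixed,
    functional calculus is pointwise in [h]. *)
Definition sdiag n (Q : 'M[C]_n) (h : 'I_n -> R) : 'M[C]_n :=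
  Q *m diag_mx (\row_i (h i)%:C) *m adjmx Q.

Lemma eq_sdiag n (Q : 'M[C]_n) g h : g =1 h -> sdiag Q g = sdiag Q h.
Proof. by move/funext ->. Qed.

Lemma conj_realC (x : R) : (x%:C)^* = x%:C :> C.
Proof. by apply/CrealP/complex_realP; exists x. Qed.

Lemma ge0_realC (z : C) : 0 <= z -> z = (complex.Re z)%:C.
Proof. by move=> z0; rewrite RRe_real // ger0_real. Qed.

Lemma sdiag_hermitian n (Q : 'M[C]_n) h : is_hermitian (sdiag Q h).
Proof.
rewrite /is_hermitian /sdiag !adjmxM adjmxK mulmxA; congr (_ *m _ *m _).
apply/matrixP => i j; rewrite adjmxE !mxE rmorphMn /= conj_realC eq_sym.
by case: eqP => [->|_].
Qed.

Lemma sdiagM n (Q : 'M[C]_n) g h : Q \is unitarymx ->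
  sdiag Q g *m sdiag Q h = sdiag Q (fun i => g i * h i).
Proof.
move=> Qu; rewrite /sdiag -!mulmxA (mulmxA (adjmx Q) Q) unitarymxEl // mul1mx.
congr (_ *m _); rewrite mulmxA mulmx_diag; congr (diag_mx _ *m _).
by apply/rowP => i; rewrite !mxE rmorphM.
Qed.

Lemma sdiag1 n (Q : 'M[C]_n) : Q \is unitarymx -> sdiag Q (fun=> 1) = 1%:M.
Proof.
move=> Qu; rewrite /sdiag (_ : diag_mx _ = 1%:M) ?mulmx1 ?unitarymxE //.
by apply/matrixP => i j; rewrite !mxE.
Qed.

Lemma sdiagZ n (Q : 'M[C]_n) (c : R) h :
  c%:C *: sdiag Q h = sdiag Q (fun i => c * h i).
Proof.
rewrite /sdiag scalemxAl scalemxAr; congr (_ *m _ *m _).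
by apply/matrixP => i j; rewrite !mxE mulrnAr rmorphM.
Qed.

Lemma sdiagD n (Q : 'M[C]_n) g h :
  sdiag Q g + sdiag Q h = sdiag Q (fun i => g i + h i).
Proof.
rewrite /sdiag -mulmxDl -mulmxDr; congr (_ *m _ *m _).
by apply/matrixP => i j; rewrite !mxE -mulrnDl rmorphD.
Qed.

Lemma sdiagX n (Q : 'M[C]_n.+1) h k : Q \is unitarymx ->
  sdiag Q h ^+ k = sdiag Q (fun i => h i ^+ k).
Proof.
move=> Qu; elim: k => [|k IH]; first exact: esym (sdiag1 Qu).
rewrite exprS IH; apply: etrans (sdiagM _ _ Qu) _.
by apply: eq_sdiag => i; rewrite exprS.
Qed.

Lemma tr_sdiag n (Q : 'M[C]_n) h : Q \is unitarymx ->
  \tr (sdiag Q h) = (\sum_i h i)%:C.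
Proof.
move=> Qu; rewrite /sdiag mxtrace_mulC mulmxA unitarymxEl // mul1mx mxtrace_diag.
by rewrite rmorph_sum; apply: eq_bigr => i _; rewrite mxE.
Qed.

Lemma sdiag_col n (Q : 'M[C]_n) h i : Q \is unitarymx ->
  sdiag Q h *m col i Q = (h i)%:C *: col i Q.
Proof.
move=> Qu; rewrite colE /sdiag -!mulmxA (mulmxA (adjmx Q) Q) unitarymxEl //.
rewrite mul1mx scalemxAr; congr (_ *m _).
apply/matrixP => k l; rewrite mul_diag_mx !mxE.
by have [->|] := eqVneq k i; rewrite ?mulr0.
Qed.

Lemma dot_col n (Q : 'M[C]_n) i j : Q \is unitarymx ->
  dot (col i Q) (col j Q) = (i == j)%:R.
Proof.
move=> Qu; have := congr1 (fun M : 'M[C]_n => M i j) (unitarymxEl Qu).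
rewrite !mxE => <-; rewrite dotE; apply: eq_bigr => k _; by rewrite !mxE.
Qed.

Lemma dot_sdiag n (Q : 'M[C]_n) h (v : 'cV[C]_n) :
  dot v (sdiag Q h *m v) = \sum_i (h i)%:C * `|dot (col i Q) v| ^+ 2.
Proof.
have colE i : dot (col i Q) v = (adjmx Q *m v) i 0.
  by rewrite mxE dotE; apply: eq_bigr => k _; rewrite !mxE.
under eq_bigr do rewrite colE.
rewrite /sdiag -!mulmxA dotMr dotE; move: (adjmx Q *m v) => w.
by apply: eq_bigr => i _; rewrite mul_diag_mx !mxE normCK; ring.
Qed.

(** Commuting Hermitian matrices are the real and imaginary parts of the normal matrix [A + 'i B],
    so diagonalizing that one diagonalizes both. The case [B = A] is the spectral theorem for a
    single Hermitian matrix. *)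
Lemma joint_spectral n (A B : 'M[C]_n) :
  is_hermitian A -> is_hermitian B -> comm_mx A B ->
  exists Q : 'M[C]_n, exists a b : 'I_n -> R,
  [/\ Q \is unitarymx, A = sdiag Q a & B = sdiag Q b].
Proof.
move=> Ah Bh AB; pose Z := A + 'i%C *: B.
have iC : ('i%C : C)^* = - 'i%C.
  by rewrite -[LHS]/('i%C^*)%C /=; apply/eqP; rewrite eq_complex /= oppr0 !eqxx.
have Zadj : adjmx Z = A - 'i%C *: B by rewrite adjmxD adjmxZ Ah Bh iC scaleNr.
have /orthomx_spectralP : Z \is normalmx.
  apply/normalmxP; change (Z *m adjmx Z = adjmx Z *m Z); rewrite Zadj.
  rewrite /Z !(mulmxDl, mulmxDr, mulmxN, mulNmx) -!scalemxAl -!scalemxAr AB.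
  by rewrite !addrA subrK addrK.
set P := spectralmx Z; set z := spectral_diag Z => ZE.
have Pu : P \is unitarymx by exact: spectral_unitarymx.
have {}ZE : Z = adjmx P *m diag_mx z *m P by rewrite ZE invmx_unitary.
have ZadjE : adjmx Z = adjmx P *m diag_mx (map_mx Num.conj z) *m P.
  by rewrite ZE !adjmxM adjmxK mulmxA /adjmx tr_diag_mx map_diag_mx.
(* The eigenvectors found are rows of [P], while [sdiag] expects columns; hence the adjoint. *)
exists (adjmx P), (fun i => complex.Re (z 0 i)), (fun i => complex.Im (z 0 i)); split.
- by rewrite trmxC_unitary.
- have -> : A = 2^-1 *: (Z + adjmx Z).
    by rewrite Zadj /Z addrACA subrr addr0 -mulr2n -(scaler_nat 2 A) scalerA mulVf
      ?pnatr_eq0 // scale1r.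
  rewrite ZE -[in X in _ + X]ZE ZadjE -mulmxDl -mulmxDr /sdiag adjmxK.
  rewrite scalemxAl scalemxAr; congr (_ *m _ *m _).
  apply/matrixP => i j; rewrite !mxE -mulrnDl mulrnAr; congr (_ *+ _).
  by rewrite -[(z 0 i)^*]/((z 0 i)^*)%C addcJ mulKf // pnatr_eq0.
- have -> : B = (2 * 'i%C)^-1 *: (Z - adjmx Z).
    rewrite Zadj /Z opprB addrC subrKA -mulr2n -(scaler_nat 2 ('i%C *: B)) !scalerA mulVf ?scale1r //.
    by rewrite mulf_neq0 ?pnatr_eq0 // eq_complex /= oner_eq0 andbF.
  rewrite ZE -[in X in _ - X]ZE ZadjE -mulmxBl -mulmxBr /sdiag adjmxK.
  rewrite scalemxAl scalemxAr; congr (_ *m _ *m _).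
  apply/matrixP => i j; rewrite !mxE -mulrnBl mulrnAr; congr (_ *+ _).
  rewrite -[(z 0 i)^*]/((z 0 i)^*)%C subcJ mulrAC mulKf //.
  by rewrite mulf_neq0 ?pnatr_eq0 // eq_complex /= oner_eq0 andbF.
Qed.

Lemma adjmx_unitary n (V : 'M[C]_n) : V \is unitarymx -> adjmx V \is unitarymx.
Proof. by move=> Vu; rewrite trmxC_unitary. Qed.

(** In the eigenbasis the energy gain is the sum of [P j * (E i - E j)] weighted by the doubly
    stochastic matrix [|W i j|^2]. Differences of a potential [phi] have weighted sum zero, so a
    potential below each term proves passivity. *)
Lemma sdiag_passive n (Q V : 'M[C]_n) (P E phi : 'I_n -> R) :
  Q \is unitarymx -> V \is unitarymx ->
  (forall i j, phi j - phi i <= P j * (E i - E j)) ->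
  \tr (sdiag Q P *m sdiag Q E) <= \tr (V *m sdiag Q P *m adjmx V *m sdiag Q E).
Proof.
move=> Qu Vu phiP; pose W := adjmx Q *m V *m Q.
have Wu : W \is unitarymx.
  exact/mul_unitarymx/Qu/mul_unitarymx/Vu/adjmx_unitary.
have -> : \tr (V *m sdiag Q P *m adjmx V *m sdiag Q E) =
    \sum_i \sum_j `|W i j| ^+ 2 * (P j * E i)%:C.
  transitivity (\tr (W *m diag_mx (\row_i (P i)%:C) *m adjmx W
     *m diag_mx (\row_i (E i)%:C))).
    rewrite mxtrace_conj (_ : adjmx W = adjmx Q *m adjmx V *m Q) //.
    by rewrite adjmxM (adjmxM (adjmx Q)) adjmxK mulmxA.
  rewrite /mxtrace; apply: eq_bigr => i _; rewrite mul_mx_diag !mxE mulr_suml.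
  apply: eq_bigr => j _; rewrite mul_mx_diag !mxE normCK rmorphM; ring.
have -> : \tr (sdiag Q P *m sdiag Q E) =
    \sum_i \sum_j `|W i j| ^+ 2 * (P j * E j)%:C.
  rewrite sdiagM // tr_sdiag // rmorph_sum exchange_big; apply: eq_bigr => j _.
  rewrite -mulr_suml (_ : \sum_i _ = 1) ?mul1r //.
  have := congr1 (fun M : 'M[C]_n => M j j) (unitarymxEl Wu).
  rewrite !mxE eqxx [true%:R]/(1 : C) => <-; apply: eq_bigr => i _.
  by rewrite !mxE normCK mulrC.
have S0 : \sum_i \sum_j `|W i j| ^+ 2 * (phi j - phi i)%:C = 0.
  under eq_bigr do under eq_bigr do rewrite rmorphB mulrBr.
  under eq_bigr do rewrite sumrB; rewrite sumrB; apply/eqP; rewrite subr_eq0; apply/eqP.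
  rewrite exchange_big; apply: eq_bigr => i _; rewrite -!mulr_suml; congr (_ * _).
  have := congr1 (fun M : 'M[C]_n => M i i) (unitarymxEl Wu).
  have := congr1 (fun M : 'M[C]_n => M i i) (unitarymxE Wu).
  rewrite !mxE eqxx [true%:R]/(1 : C) => WW WW'; transitivity (1 : C).
    by rewrite -WW'; apply: eq_bigr => k _; rewrite !mxE normCK mulrC.
  by rewrite -WW; apply: eq_bigr => k _; rewrite !mxE normCK.
rewrite -subr_ge0 -[leLHS]S0 -sumrB; apply: ler_sum => i _; rewrite -sumrB.
apply: ler_sum => j _; rewrite -mulrBr -rmorphB -mulrBr.
by apply: ler_wpM2l; rewrite ?exprn_ge0 // lecR.
Qed.

End Spectral.

(** * Spectral decompositions of tensor powers *)

Section SpectralTensor.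

Variables (R : realType) (d' : nat).
Local Notation d := d'.+1.
Local Notation C := R[i].

Lemma ntensmx_sdiag (Q : 'M[C]_d) h n :
  ntensmx (sdiag Q h) n =
  sdiag (ntensmx Q n) (fun i => \prod_(k < n) h (dig d' n k i)).
Proof.
rewrite /sdiag !ntensmxM adjmx_ntensmx; congr (_ *m _ *m _).
rewrite ntensmxE; apply/matrixP => i j; rewrite !mxE.
have [->|ij] := eqVneq i j.
  by rewrite mulr1n rmorph_prod; apply: eq_bigr => k _; rewrite !mxE eqxx mulr1n.
case: (pickP (fun k : 'I_n => dig d' n k i != dig d' n k j)) => [k kij|same].
  by rewrite (bigD1 k) //= !mxE (negPf kij) mulr0n mul0r.
case/eqP: ij; apply: val_inj; apply: (@dig_inj d' n) => [||k kn]; try exact: ltn_ord.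
by have /negbFE/eqP := same (Ordinal kn).
Qed.

Lemma total_hamiltonian_sdiag (Q : 'M[C]_d) h n : Q \is unitarymx ->
  total_hamiltonian (sdiag Q h) n =
  sdiag (ntensmx Q n) (fun i => \sum_(k < n) h (dig d' n k i)).
Proof.
move=> Qu.
have -> : sdiag (ntensmx Q n) (fun i => \sum_(k < n) h (dig d' n k i)) =
    \sum_(j < n) sdiag (ntensmx Q n) (fun i => h (dig d' n j i)).
  rewrite /sdiag -mulmx_suml -mulmx_sumr; congr (_ *m _ *m _).
  apply/matrixP => i j; rewrite summxE !mxE rmorph_sum -sumrMnl.
  by apply: eq_bigr => k _; rewrite !mxE.
rewrite total_hamiltonianE; apply: eq_bigr => j _.
(* A one-site energy is rewritten as a product over all sites, equal to 1 away from j, to match a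
   tensor product of operators. *)
have -> : sdiag (ntensmx Q n) (fun i => h (dig d' n j i)) =
   sdiag (ntensmx Q n) (fun i => \prod_(k < n) (if k == j then h (dig d' n k i) else 1)).
  by apply: eq_sdiag => i; rewrite -big_mkcond big_pred1_eq.
have -> : tensf (fun k => if k == j then sdiag Q h else 1%:M) n =
   tensf (fun k => sdiag Q (fun i => if k == j then h i else 1)) n.
  by apply: eq_tensf => k _; case: ifP => // _; rewrite sdiag1.
rewrite /sdiag -!tensfM adjmx_ntensmx !ntensmxE; congr (_ *m _ *m _).
apply/matrixP => i l; rewrite !mxE.
have [->|il] := eqVneq i l.
  by rewrite mulr1n rmorph_prod; apply: eq_bigr => k _; rewrite !mxE eqxx mulr1n.
case: (pickP (fun k : 'I_n => dig d' n k i != dig d' n k l)) => [k kij|same].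
  by rewrite (bigD1 k) //= !mxE (negPf kij) mulr0n mul0r.
case/eqP: il; apply: val_inj; apply: (@dig_inj d' n) => [||k kn]; try exact: ltn_ord.
by have /negbFE/eqP := same (Ordinal kn).
Qed.

Lemma completely_passive_sdiag (Q : 'M[C]_d) (h p : 'I_d -> R) :
  Q \is unitarymx ->
  (forall n, exists phi : 'I_(d ^ n) -> R, forall i j,
     phi j - phi i <= (\prod_(k < n) p (dig d' n k j)) *
       (\sum_(k < n) h (dig d' n k i) - \sum_(k < n) h (dig d' n k j))) ->
  completely_passive (sdiag Q h) (sdiag Q p).
Proof.
move=> Qu hp n _; split.
  exists 1%:M; first by apply/unitarymxP; rewrite -[X in _ *m X]/(adjmx _) adjmx1 mulmx1.
  by rewrite /extracted_work adjmx1 mul1mx mulmx1 subrr.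
move=> _ [V Vu <-]; rewrite /extracted_work subr_le0 ntensmx_sdiag.
rewrite (total_hamiltonian_sdiag h n Qu); case: (hp n) => phi.
exact/sdiag_passive/Vu/ntensmx_unitary.
Qed.

End SpectralTensor.

(** * Gibbs and ground states are completely passive *)

Section Sufficiency.

Variables (R : realType) (d' : nat).
Local Notation d := d'.+1.
Local Notation C := R[i].
Import numFieldNormedType.Exports.
Local Open Scope classical_set_scope.

Lemma cvg_realC (u : nat -> R) (l : R) :
  u @ \oo --> l -> (fun n => (u n)%:C : (C : numFieldType)) @ \oo --> (l%:C : (C : numFieldType)).
Proof.
move=> /cvgrPdist_lt ul; apply/cvgrPdist_lt => e e0.
have eE := ge0_realC (ltW e0).
have {}e0 : 0 < complex.Re e by rewrite -ltcR -eE.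
near=> n; rewrite -rmorphB normc_def /= expr0n addr0 sqrtr_sqr eE ltcR.
by near: n; exact: ul.
Unshelve. all: by end_near.
Qed.

(** Every partial sum of the series is a combination of the fixed spectral projections [E i] whose
    coefficients are scalar exponential sums, so the limit is taken coefficientwise. *)
Lemma expmx_sdiag (Q : 'M[C]_d) (h : 'I_d -> R) : Q \is unitarymx ->
  expmx (sdiag Q h) = sdiag Q (fun i => expR (h i)).
Proof.
move=> Qu; pose E i : 'M[C]_d := Q *m delta_mx i i *m adjmx Q.
have sdiagE g : sdiag Q g = \sum_i (g i)%:C *: E i.
  rewrite /sdiag /E; under eq_bigr do rewrite scalemxAl scalemxAr.
  rewrite -mulmx_suml -mulmx_sumr; congr (_ *m _ *m _).
  apply/matrixP => i j; rewrite summxE !mxE (bigD1 i) //= big1 => [|k ki].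
    by rewrite !mxE eqxx eq_sym addr0; case: eqP; rewrite /= ?mulr1 ?mulr0.
  by rewrite !mxE eq_sym (negPf ki) mulr0.
apply: cvg_lim; first exact: norm_hausdorff.
have -> : series (fun k : nat => k`!%:R^-1 *: sdiag Q h ^+ k) =
    (fun m => \sum_i (series (exp_coeff (h i)) m)%:C *: E i).
  apply/funext => m; rewrite /series /= -sdiagE.
  elim: m => [|m IH].
    rewrite big_nil sdiagE big1 // => i _; by rewrite big_nil scale0r.
  rewrite big_nat_recr //= IH sdiagX //.
  have -> : (m`!%:R^-1 : C) = (m`!%:R^-1 : R)%:C by rewrite fmorphV rmorph_nat.
  rewrite sdiagZ sdiagD; apply: eq_sdiag => i.
  by rewrite big_nat_recr //= /exp_coeff /= [X in _ + X]mulrC.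
rewrite sdiagE; apply: cvg_big => [|i _]; first exact: add_continuous.
apply: cvgZr_tmp; apply: cvg_realC; exact: is_cvg_series_exp_coeff.
Qed.

Lemma gibbs_sdiag (Q : 'M[C]_d) (h : 'I_d -> R) beta : Q \is unitarymx ->
  gibbs_state (sdiag Q h) beta =
  sdiag Q (fun i => (\sum_j expR (- beta * h j))^-1 * expR (- beta * h i)).
Proof.
by move=> Qu; rewrite /gibbs_state sdiagZ expmx_sdiag // tr_sdiag // -fmorphV sdiagZ.
Qed.

Lemma eigenvalue_sdiag (Q : 'M[C]_d) (h : 'I_d -> R) e : Q \is unitarymx ->
  eigenvalue (sdiag Q h) e <-> exists i, e = (h i)%:C.
Proof.
move=> Qu; split.
  case/eigenvalueP => v ve v0.
  have vQ0 : v *m Q != 0.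
    by apply: contraNneq v0 => vQ; rewrite -(mulmx1 v) -(unitarymxE Qu) mulmxA vQ mul0mx.
  have /rV0Pn[i vi] := vQ0.
  have vQe : v *m Q *m diag_mx (\row_i (h i)%:C) = e *: (v *m Q).
    rewrite scalemxAl -ve /sdiag !mulmxA -[RHS]mulmxA unitarymxEl //.
    by rewrite mulmx1.
  exists i; have := congr1 (fun M : 'rV[C]_d => M 0 i) vQe.
  move: (v *m Q) vi => w wi.
  by rewrite mul_mx_diag !mxE mulrC => /(mulIf wi) ->.
case=> i ->; apply/eigenvalueP; exists (adjmx (col i Q)).
  rewrite -{1}[sdiag Q h](sdiag_hermitian Q h) -adjmxM sdiag_col // adjmxZ.
  by rewrite conj_realC.
apply/eqP => /(congr1 (@adjmx R _ _)); rewrite adjmxK adjmx0 => c0.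
by have /eqP := dot_col i i Qu; rewrite c0 dot0l eqxx eq_sym oner_eq0.
Qed.

Lemma sdiag_state_ge0 (Q : 'M[C]_d) (p : 'I_d -> R) i : Q \is unitarymx ->
  is_psd (sdiag Q p) -> 0 <= p i.
Proof.
move=> Qu /(psd_dot_ge0 (col i Q)).
by rewrite sdiag_col // dotZr dot_col // eqxx mulr1 lecR.
Qed.

Lemma ground_completely_passive (H rho : 'M[C]_d) :
  is_hermitian H -> is_ground_state H rho -> completely_passive H rho.
Proof.
move=> Hh [[rh rp _] [e [e_eig e_min /eigenspaceP re]]].
have Hr : comm_mx rho H.
  (* The support condition reads [rho *m H = e *: rho]; its adjoint, with [e] real, gives the same
     value for [H *m rho]. *)
  have := congr1 (@adjmx R _ _) re; rewrite adjmxM adjmxZ rh Hh => re'.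
  have e_real : e^* = e.
    case: (joint_spectral Hh Hh erefl) e_eig => Q [h [_ [Qu -> _]]].
    by case/(eigenvalue_sdiag _ _ Qu) => i ->; rewrite conj_realC.
  by rewrite /comm_mx re re' e_real.
case: (joint_spectral rh Hh Hr) => Q [p [h [Qu rE HE]]].
have p0 i : 0 <= p i by apply: (sdiag_state_ge0 i Qu); rewrite -rE.
have ph i j : p i != 0 -> h i <= h j.
  move=> pi0; rewrite -lecR; have <- : e = (h i)%:C.
    have := congr1 (mulmx^~ (col i Q)) re.
    rewrite -mulmxA -scalemxAl HE sdiag_col // -scalemxAr rE sdiag_col //.
    rewrite !scalerA => /(congr1 (dot (col i Q))); rewrite !dotZr dot_col // eqxx !mulr1.
    by move/(mulIf _) => -> //; rewrite (inj_eq (@complexI _)).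
  by apply: e_min; rewrite HE; apply/eigenvalue_sdiag => //; exists j.
rewrite HE rE; apply: completely_passive_sdiag => // n.
(* A constant potential suffices: a string of nonzero weight has minimal energy at every site. *)
exists (fun=> 0) => i j; rewrite subrr.
have [P0|] := eqVneq (\prod_(k < n) p (dig d' n k j)) 0; first by rewrite P0 mul0r.
move=> /prodf_neq0 pn0; rewrite mulr_ge0 ?prodr_ge0 // subr_ge0.
by apply: ler_sum => k _; apply: ph; exact: pn0.
Qed.

(** For [beta > 0] the potential is the weight divided by [beta], and the required bound is
    [1 + x <= expR x]. For [beta = 0] the weights are constant and the potential is a multiple of
    the energy. *)
Lemma gibbs_completely_passive (H : 'M[C]_d) beta :
  is_hermitian H -> 0 <= beta -> completely_passive H (gibbs_state H beta).
Proof.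
move=> Hh; case: (joint_spectral Hh Hh erefl) => Q [h [_ [Qu -> _]]].
rewrite gibbs_sdiag //; set z := (\sum_j _)^-1 => beta0.
have z0 : 0 <= z by rewrite invr_ge0 sumr_ge0 // => i _; exact: expR_ge0.
apply: completely_passive_sdiag => // n.
pose E i := \sum_(k < n) h (dig d' n k i).
have PE i : \prod_(k < n) (z * expR (- beta * h (dig d' n k i))) =
    z ^+ n * expR (- beta * E i).
  by rewrite big_split /= prodr_const card_ord -expR_sum mulr_sumr.
have [b0|bn0] := eqVneq beta 0.
  exists (fun i => - (z ^+ n * E i)) => i j; rewrite PE -/(E i) -/(E j) b0.
  by rewrite oppr0 mul0r expR0 mulr1 mulrBr opprK addrC.
have {bn0}beta0 : 0 < beta by rewrite lt0r bn0.
exists (fun i => z ^+ n * expR (- beta * E i) / beta) => i j.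
rewrite PE -/(E i) -/(E j) -mulrBl -mulrBr -!mulrA ler_wpM2l ?exprn_ge0 //.
rewrite ler_pdivrMr //.
have -> : expR (- beta * E i) = expR (- beta * E j) * expR (- beta * (E i - E j)).
  by rewrite -expRD; congr expR; ring.
have := expR_ge1Dx (- beta * (E i - E j)).
have := expR_gt0 (- beta * E j).
move: (expR _) (expR _) => a b; nra.
Qed.

End Sufficiency.

(** * Power sums *)

Section PowerSums.

(** Sum the polynomial ['X * q] over the values, where [q] vanishes at every value other than
    [w i0]. It has no constant term, so the sum is 0; yet only the copies of [w i0] contribute,
    which forces [w i0 = 0]. *)
Lemma power_sums_eq0 (K : numFieldType) (I : finType) (P : pred I) (w : I -> K) :
  (forall m, (0 < m)%N -> \sum_(i | P i) w i ^+ m = 0) ->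
  forall i, P i -> w i = 0.
Proof.
move=> w0 i0 Pi0; apply/eqP; case: (boolP (w i0 == 0)) => // wi0.
pose q := \prod_(j | w j != w i0) ('X - (w j)%:P).
have q0 : q.[w i0] != 0.
  rewrite horner_prod; apply/prodf_neq0 => j wj.
  by rewrite hornerXsubC subr_eq0 eq_sym.
have : \sum_(i | P i) ('X * q).[w i] = 0.
  under eq_bigr do rewrite horner_coef.
  rewrite exchange_big big1 //= => k _; rewrite -mulr_sumr.
  by case: (k : nat) => [|m]; rewrite ?coefXM ?eqxx ?mul0r // w0 ?mulr0.
rewrite (bigID (fun i => w i == w i0)) /= [X in _ + X]big1 => [|i /andP[_ wi]].
  under eq_bigr => i /andP[_ /eqP->] do rewrite hornerM hornerX.
  rewrite addr0 sumr_const -mulr_natr => /eqP.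
  rewrite !mulf_eq0 (negPf wi0) (negPf q0) pnatr_eq0 /= => /eqP/card0_eq/(_ i0).
  by rewrite unfold_in /= Pi0 eqxx.
rewrite hornerM horner_prod (bigD1 i) //= hornerXsubC subrr mul0r mulr0 //.
Qed.

(* Test on the moment curve [(1, x, x^2, ...)]: a nonzero row becomes a nonzero
   polynomial in x, and finitely many of these have a common non-root. *)
Lemma union_kernels (K : numFieldType) (I : finType) (P : pred I) m n
    (A : I -> 'M[K]_(m, n)) :
  (forall v : 'cV[K]_n, exists2 i, P i & A i *m v = 0) ->
  exists2 i, P i & A i = 0.
Proof.
move=> cover; case: (pickP (fun i => P i && (A i == 0))) => [i /andP[Pi /eqP]|A0].
  by exists i.
have {}A0 i : P i -> A i != 0 by move=> Pi; have := A0 i; rewrite Pi /= => /negbT.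
have rowP i : exists r, P i -> exists c, A i r c != 0.
  have [Pi|] := boolP (P i); last first.
    (* A row index is needed even outside [P]. There are none when [m = 0], but then the matrix that
       the hypothesis supplies for the zero vector is 0, which is excluded. *)
    move=> nPi; case: m A cover A0 => [|m] A cover A0; last by exists ord0.
    by case: (cover 0) => j Pj _; case/eqP: (A0 j Pj); apply/matrixP => -[].
  by have /matrix0Pn[r [c rc]] := A0 i Pi; exists r => _; exists c.
case: (fin_all_exists rowP) => r rP.
pose p i : {poly K} := \sum_(c < n) A i (r i) c *: 'X^c.
have p0 i : P i -> p i != 0.
  case/rP => c; apply: contra => /eqP pi0; have := coef0 K c; rewrite -pi0 /p coef_sum.
  rewrite (bigD1 c) //= big1 => [|k kc]; rewrite coefZ coefXn ?eqxx ?mulr1 ?addr0.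
    by move->.
  by rewrite eq_sym (inj_eq val_inj) (negPf kc) mulr0.
pose q := \prod_(i | P i) p i.
have q0 : q != 0 by apply/prodf_neq0.
have [x xq] : exists x : K, ~~ root q x.
  pose s := [seq k%:R : K | k <- iota 0 (size q)].
  have [/allP sq|/allPn[x _]] := boolP (all (root q) s); last by exists x.
  have s_uniq : uniq s.
    by rewrite map_inj_uniq ?iota_uniq // => a b /eqP; rewrite eqr_nat => /eqP.
  have := max_poly_roots q0 (introT allP sq) s_uniq.
  by rewrite size_map size_iota ltnn.
case: (cover (\col_c x ^+ c)) => i Pi /(congr1 (fun M : 'cV[K]_m => M (r i) 0)).
rewrite !mxE => pix; case/negP: xq; apply/rootP.
rewrite horner_prod (bigD1 i) //= (_ : (p i).[x] = 0) ?mul0r // -{}pix.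
rewrite horner_sum; apply: eq_bigr => c _.
by rewrite hornerZ hornerXn mxE.
Qed.

Variable R : realType.
Local Notation C := R[i].

Import numFieldNormedType.Exports.
Local Open Scope classical_set_scope.

Lemma sum_geometric_small (I : finType) (P : pred I) (r : I -> R) e :
  (forall i, P i -> 0 <= r i < 1) -> 0 < e ->
  exists m0, forall m, (m0 <= m)%N -> \sum_(i | P i) r i ^+ m < e.
Proof.
move=> r01 e0.
have : (fun m => \sum_(i | P i) r i ^+ m) @ \oo --> \sum_(i | P i) (0 : R).
  apply: cvg_big => [|i Pi]; first exact: add_continuous.
  by case/andP: (r01 i Pi) => r0 r1; apply: cvg_expr; rewrite ger0_norm.
rewrite big1 // => /cvgrPdist_lt/(_ e e0)[m0 _ small].
exists m0 => m /small /=; rewrite sub0r normrN ger0_norm // sumr_ge0 // => i Pi.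
by case/andP: (r01 i Pi) => r0 r1; rewrite exprn_ge0.
Qed.

(** The constant [c] disappears in the limit: if every [F i] were below [T], the sum of the
    [(F i / T) ^+ m] would tend to 0 and drop below [c]. *)
Lemma le_of_powers (I : finType) (P : pred I) (F : I -> R) (c T : R) i0 m0 :
  P i0 -> (forall i, P i -> 0 <= F i) -> 0 <= T -> 0 < c ->
  (forall m, (m0 <= m)%N -> c * T ^+ m <= \sum_(i | P i) F i ^+ m) ->
  exists2 i, P i & T <= F i.
Proof.
move=> Pi0 F0 T0 c0 le.
case: (pickP (fun i => P i && (T <= F i))) => [i /andP[]|FT]; first by exists i.
have {}FT i : P i -> F i < T by move=> Pi; have := FT i; rewrite Pi /= leNgt => /negbFE.
have {}T0 : 0 < T by apply: le_lt_trans (FT _ Pi0); exact: F0.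
have r01 i : P i -> 0 <= F i / T < 1.
  by move=> Pi; rewrite divr_ge0 ?F0 1?ltW //= ltr_pdivrMr // mul1r FT.
have [m1 small] := sum_geometric_small r01 c0.
have := small _ (leq_maxl m1 m0); rewrite ltNge => /negP[].
under eq_bigr do rewrite expr_div_n.
by rewrite -mulr_suml ler_pdivlMr ?exprn_gt0 // le // leq_maxr.
Qed.

(** The terms with [z i = 1] contribute a positive integer, at least 1, and the remaining power sum
    eventually has modulus at most 1/2. *)
Lemma power_sum_norm_ge (I : finType) (P : pred I) (z : I -> C) i0 :
  P i0 -> z i0 = 1 -> (forall i, P i -> z i = 1 \/ `|z i| < 1) ->
  exists m0, forall m, (m0 <= m)%N -> 2^-1 <= `|\sum_(i | P i) z i ^+ m|.
Proof.
move=> Pi0 zi0 zP.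
pose r i := complex.Re `|z i|.
have rE i : `|z i| = (r i)%:C by rewrite [LHS]ge0_realC.
have r01 i : P i && (z i != 1) -> 0 <= r i < 1.
  case/andP=> Pi zi1; rewrite -!lecR -ltcR -rE normr_ge0 /=.
  by case: (zP i Pi) => // /eqP; rewrite (negPf zi1).
have half0 : 0 < 2^-1 :> R by rewrite invr_gt0 ltr0n.
have [m0 small] := sum_geometric_small r01 half0.
exists m0 => m /small {}small.
rewrite (bigID (fun i => z i == 1)) /=.
have -> : \sum_(i | P i && (z i == 1)) z i ^+ m = #|[pred i | P i && (z i == 1)]|%:R.
  by rewrite (eq_bigr (fun=> 1)) ?sumr_const // => i /andP[_ /eqP->]; rewrite expr1n.
set S := \sum_(i | _) _.
have S_small : `|S| <= 2^-1.
  apply: le_trans (ler_norm_sum _ _ _) _.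
  have -> : (2^-1 : C) = (2^-1 : R)%:C by rewrite fmorphV rmorph_nat.
  under eq_bigr do rewrite normrX rE -rmorphXn.
  by rewrite -rmorph_sum lecR ltW.
have k1 : 1 <= `|#|[pred i | P i && (z i == 1)]|%:R : C|.
  rewrite normr_nat ler1n; apply/card_gt0P; exists i0.
  by rewrite !inE Pi0 zi0 eqxx.
rewrite -[in leRHS](opprK S); apply: le_trans (lerB_dist _ _).
rewrite normrN lerBrDr (le_trans _ k1) //.
apply: le_trans (lerD (lexx _) S_small) _.
by rewrite [leRHS]splitr mul1r.
Qed.

End PowerSums.

(** * Reflections *)

Section Householder.

Variable R : realType.
Local Notation C := R[i].

Definition householder n (v : 'cV[C]_n) : 'M[C]_n :=
  1%:M - (2 / dot v v) *: (v *m adjmx v).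

Lemma adjmx_householder n (v : 'cV[C]_n) : adjmx (householder v) = householder v.
Proof.
rewrite adjmxD adjmxN adjmxZ adjmx1 adjmxM adjmxK rmorphM fmorphV /= dotC.
by rewrite conjC_nat.
Qed.

Lemma mul_adj_mx11 n (v w : 'cV[C]_n) : adjmx v *m w = (dot v w)%:M.
Proof. by rewrite [LHS]mx11_scalar. Qed.

Lemma householder_unitary n (v : 'cV[C]_n) : v != 0 -> householder v \is unitarymx.
Proof.
move=> v0; have q0 : dot v v != 0 by rewrite dot_eq0.
apply/unitarymxP; change (householder v *m adjmx (householder v) = 1%:M).
rewrite adjmx_householder /householder mulmxBl mul1mx mulmxBr mulmx1.
rewrite -scalemxAl -scalemxAr mulmxA -(mulmxA v) mul_adj_mx11 mul_mx_scalar.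
rewrite -scalemxAl !scalerA -scalerBl -addrA -opprD -scalerDl.
rewrite [X in _ - X *: _](_ : _ = 0) ?scale0r ?subr0 //; by field.
Qed.

(** A unitary that fixes the ket [v] fixes its bra too, hence commutes with [v *m adjmx v]. This is
    the source of invariant unitaries. *)
Lemma householder_comm n (W : 'M[C]_n) (v : 'cV[C]_n) :
  W \is unitarymx -> W *m v = v -> comm_mx (householder v) W.
Proof.
move=> Wu Wv; have vW : adjmx v *m W = adjmx v.
  by rewrite -{1}Wv adjmxM -mulmxA unitarymxEl // mulmx1.
rewrite /comm_mx mulmxBl mulmxBr mul1mx mulmx1 -scalemxAl -scalemxAr.
by rewrite mulmxA Wv -mulmxA vW.
Qed.

(** Expand the trace in [M = v *m adjmx v]; as [M] has rank one, [M *m P *m M] is a multiple of [M].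
    Multiplying twice by [dot v v] clears the denominators. *)
Lemma householder_work n (P E : 'M[C]_n) (v : 'cV[C]_n) :
  is_hermitian P -> is_hermitian E -> v != 0 ->
  \tr (P *m E) <=
    \tr (householder v *m P *m adjmx (householder v) *m E) ->
  dot v v * (dot (P *m v) (E *m v) + dot (E *m v) (P *m v)) <=
    2 * (dot v (P *m v) * dot v (E *m v)).
Proof.
move=> Ph Eh v0; rewrite adjmx_householder.
have q0 : 0 < dot v v by rewrite dot_gt0.
have trE (M : 'M[C]_n) : \tr (v *m adjmx v *m M) = dot v (M *m v).
  by rewrite -mulmxA mxtrace_mulC /mxtrace big_ord1 /dot mulmxA.
set M := v *m adjmx v.
have MPM : M *m P *m M = dot v (P *m v) *: M.
  have -> : M *m P *m M = v *m (adjmx v *m (P *m v)) *m adjmx v by rewrite /M !mulmxA.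
  by rewrite mul_adj_mx11 mul_mx_scalar -scalemxAl.
have -> : \tr (householder v *m P *m householder v *m E) =
    \tr (P *m E) - 2 / dot v v * (dot (P *m v) (E *m v) + dot (E *m v) (P *m v))
    + (2 / dot v v) ^+ 2 * (dot v (P *m v) * dot v (E *m v)).
  rewrite /householder -/M; set a := 2 / dot v v.
  move: trE MPM; rewrite -/M; move: M => M trE MPM.
  have -> : (1%:M - a *: M) *m P *m (1%:M - a *: M) =
      P - a *: (M *m P) - a *: (P *m M) + a ^+ 2 *: (M *m P *m M).
    rewrite !(mulmxBl, mulmxBr, mul1mx, mulmx1) -!scalemxAr -!scalemxAl scalerA.
    by rewrite opprB addrA addrAC.
  rewrite MPM mulmxDl !mulmxBl -!scalemxAl mxtraceD !raddfB /= !mxtraceZ.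
  have -> : \tr (P *m M *m E) = \tr (M *m (E *m P)).
    by rewrite -mulmxA mxtrace_mulC -mulmxA.
  rewrite -mulmxA !trE -!mulmxA -(hermitian_dot v _ Ph) -(hermitian_dot v _ Eh).
  ring.
rewrite -addrA lerDl addrC subr_ge0 => le.
have := ler_wpM2l (ltW q0) (ler_wpM2l (ltW q0) le).
set x := dot _ _ + _; set y := dot _ _ * _.
have -> : dot v v * (dot v v * (2 / dot v v * x)) = 2 * (dot v v * x).
  by field; rewrite gt_eqF.
have -> : dot v v * (dot v v * ((2 / dot v v) ^+ 2 * y)) = 2 * (2 * y).
  by field; rewrite gt_eqF.
by rewrite ler_pM2l.
Qed.

(* Maximality of the energy-ordered weights is tested on the reflections along
   [psi + z phi]; small [z] also kills the off-diagonal term. *)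
Lemma reflection_passive n (P E : 'M[C]_n) (psi phi : 'cV[C]_n) (e1 e2 : R) :
  is_hermitian P -> is_hermitian E -> is_psd P ->
  E *m psi = e1%:C *: psi -> E *m phi = e2%:C *: phi -> e1 < e2 ->
  (forall z, psi + z *: phi != 0 ->
    let V := householder (psi + z *: phi) in
    \tr (P *m E) <= \tr (V *m P *m adjmx V *m E)) ->
  dot psi psi * dot phi (P *m phi) <= dot phi phi * dot psi (P *m psi) /\
  (psi != 0 -> dot psi (P *m phi) = 0).
Proof.
move=> Ph Eh Pp Epsi Ephi e12 passive.
have ortho : dot psi phi = 0.
  have := hermitian_dot psi phi Eh; rewrite Epsi Ephi dotZl dotZr conj_realC.
  move/eqP; rewrite -subr_eq0 -mulrBl -rmorphB mulf_eq0 => /orP[|/eqP//].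
  by rewrite (inj_eq (@complexI _) _ 0) subr_eq0 lt_eqF.
have ortho' : dot phi psi = 0 by rewrite -dotC ortho conjC0.
set A := dot psi (P *m psi); set B := dot phi (P *m phi).
set N := dot psi psi; set F := dot phi phi; set X := dot psi (P *m phi).
have X'E : dot phi (P *m psi) = X^* by rewrite dotC hermitian_dot.
(* [householder_work] along [psi + z *: phi], with the positive factor [e2 - e1] removed. *)
have key z : 0 <= 2 * (z * z^*) * (F * A - N * B) +
    (z * X + z^* * X^*) * (z * z^* * F - N).
  have : dot (psi + z *: phi) (psi + z *: phi) *
     (dot (P *m (psi + z *: phi)) (E *m (psi + z *: phi)) +
      dot (E *m (psi + z *: phi)) (P *m (psi + z *: phi))) <=
     2 * (dot (psi + z *: phi) (P *m (psi + z *: phi)) *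
      dot (psi + z *: phi) (E *m (psi + z *: phi))).
    have [->|v0] := eqVneq (psi + z *: phi) 0; first by rewrite !dot0l !(mul0r, mulr0).
    exact: householder_work v0 (passive z v0).
  rewrite -subr_ge0 (_ : _ - _ = (e2%:C - e1%:C) *
    (2 * (z * z^*) * (F * A - N * B) + (z * X + z^* * X^*) * (z * z^* * F - N))).
    by rewrite pmulr_rge0 // subr_gt0 ltcR.
  rewrite !mulmxDr -!scalemxAr Epsi Ephi !dot_combination !dotZl !dotZr.
  rewrite !(hermitian_dot _ _ Ph) ortho ortho' !conj_realC.
  rewrite X'E -/A -/B -/N -/F -/X; ring.
(* Adding the cases [z = 1] and [z = -1] cancels the part odd in [z]. *)
have FA : N * B <= F * A.
  have := addr_ge0 (key 1) (key (-1)); rewrite !rmorphN !rmorph1.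
  rewrite [leRHS](_ : _ = 4 * (F * A - N * B)); last by ring.
  by rewrite pmulr_rge0 ?ltr0n // subr_ge0.
split => // psi0; apply/eqP; case: (boolP (X == 0)) => // X0.
have N0 : 0 < N by rewrite dot_gt0.
have Y0 : 0 < X * X^* by rewrite mul_conjC_gt0.
pose D := F * A - N * B; have D0 : 0 <= D by rewrite subr_ge0.
have F0 : 0 <= F by exact: dot_ge0.
pose S := D + X * X^* * F + N.
have S0 : 0 < S by rewrite ltr_wpDl // addr_ge0 // mulr_ge0 // ltW.
(* At [z = eps * X^*] with [eps <= 1], the bracket in [key] is at most [eps * S - N]; this choice
   makes that bound [- (N / 2)], a contradiction. *)
pose eps := N / (2 * S).
have eps0 : 0 < eps by apply: divr_gt0 => //; rewrite mulr_gt0 // ltr0n.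
have epsC : eps^* = eps by apply/CrealP; rewrite ger0_real // ltW.
have := key (eps * X^*); rewrite rmorphM /= conjCK epsC.
rewrite [leRHS](_ : _ = 2 * eps * (X * X^*) *
   (eps * D + eps * (eps * (X * X^*) * F) - N)); last by rewrite /D; ring.
have c0 : 0 < 2 * eps * (X * X^*).
  by apply: mulr_gt0 => //; apply: mulr_gt0 => //; rewrite ltr0n.
rewrite (pmulr_rge0 _ c0) => {}key.
have eps1 : eps <= 1.
  rewrite ler_pdivrMr ?mulr_gt0 ?ltr0n // mul1r.
  apply: le_trans (_ : N <= S) _.
    by rewrite lerDr addr_ge0 // mulr_ge0 // ltW.
  by rewrite mulr_natl mulr2n lerDl ltW.
have : 0 <= eps * S - N.
  apply: le_trans key _; rewrite lerD2r.
  have -> : eps * S = eps * D + (eps * (X * X^* * F) + eps * N) by rewrite /S; ring.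
  rewrite lerD2l.
  apply: ler_wpDr; first by rewrite mulr_ge0 // ltW.
  rewrite ler_pM2l // -mulrA ler_piMl //.
  by rewrite mulr_ge0 // ltW.
have -> : eps * S - N = - (N / 2) by rewrite /eps; field; rewrite gt_eqF.
by rewrite oppr_ge0 lt_geF // divr_gt0 // ltr0n.
Qed.

End Householder.

(** * Twirled tensor powers *)

Section Twirl.

Variables (R : realType) (d' : nat).
Local Notation d := d'.+1.
Local Notation C := R[i].

Lemma ntensmx_psd (rho : 'M[C]_d) n :
  is_hermitian rho -> is_psd rho -> is_psd (ntensmx rho n).
Proof.
move=> rh rp v; case: (joint_spectral rh rh erefl) => Q [p [_ [Qu rE _]]].
rewrite matrix_dotE rE ntensmx_sdiag dot_sdiag; apply: sumr_ge0 => i _.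
rewrite mulr_ge0 ?exprn_ge0 // lecR; apply: prodr_ge0 => k _.
by apply: (sdiag_state_ge0 _ Qu); rewrite -rE.
Qed.

Lemma unitary_scalar (A : 'M[C]_d) w : A \is unitarymx -> A *m A = w *: A -> A = w%:M.
Proof.
move=> /unitarymx_unit Au AA; apply: (can_inj (mulKmx Au)).
by rewrite AA mul_mx_scalar.
Qed.

(* Rescaled to unit determinants, the cocycle takes values in d-th roots of
   unity, so that tensor powers of exponent divisible by K are representations. *)
Lemma projective_repr_normalize (gT : finGroupType) (G : {group gT})
    (U : gT -> 'M[C]_d) :
  is_projective_unitary_repr G U ->
  exists (u : gT -> 'M[C]_d) (K : nat),
  [/\ (0 < K)%N,
      forall g, g \in G -> u g \is unitarymx,
      forall g, exists2 c : C, c != 0 & U g = c *: u g,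
      forall g h, g \in G -> h \in G ->
        exists2 w : C, w ^+ K = 1 & u g *m u h = w *: u (g * h)%g &
      forall g, g \in G -> u g ^+ K = 1].
Proof.
move=> [Uu [omega Uomega]].
(* The value 1 outside [G] keeps [nu] nonzero everywhere: the third clause ranges over all [g]. *)
pose nu g := if g \in G then d.-root (\det (U g)) else 1.
have nuX g : g \in G -> nu g ^+ d = \det (U g) by rewrite /nu => ->; exact: rootCK.
have detU1 g : g \in G -> `|\det (U g)| = 1.
  move=> gG; apply/eqP; rewrite -(@pexpr_eq1 _ _ 2) // normCK.
  have := congr1 determinant (unitarymxE (Uu g gG)).
  by rewrite det_mulmx det1 /adjmx det_map_mx det_tr => /eqP.
have nu1 g : `|nu g| = 1.
  have [gG|ngG] := boolP (g \in G); last by rewrite /nu (negPf ngG) normr1.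
  by apply/eqP; rewrite -(@pexpr_eq1 _ _ d) // -normrX nuX // detU1.
have nu0 g : nu g != 0 by rewrite -normr_eq0 nu1 oner_eq0.
pose u g := (nu g)^-1 *: U g.
have uu g : g \in G -> u g \is unitarymx.
  move=> gG; apply/unitarymxP; change (u g *m adjmx (u g) = 1%:M).
  rewrite adjmxZ -scalemxAl -scalemxAr scalerA unitarymxE ?Uu //.
  by rewrite fmorphV -invfM -normCK nu1 expr1n invr1 scale1r.
have det_u g : g \in G -> \det (u g) = 1.
  move=> gG; rewrite detZ exprVn nuX // mulVf //.
  by rewrite -normr_eq0 detU1 ?oner_eq0.
have umul g h : g \in G -> h \in G ->
    exists2 w : C, w ^+ d = 1 & u g *m u h = w *: u (g * h)%g.
  move=> gG hG; have [_ UU] := Uomega g h gG hG.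
  have ugh : u g *m u h =
      ((nu g)^-1 * ((nu h)^-1 * omega g h) * nu (g * h)%g) *: u (g * h)%g.
    by rewrite -scalemxAl -scalemxAr UU !scalerA mulfK // mulrA.
  exists ((nu g)^-1 * ((nu h)^-1 * omega g h) * nu (g * h)%g) => //.
  (* All determinants are 1, so the scalar is a d-th root of unity. *)
  have := congr1 determinant ugh.
  by rewrite det_mulmx (detZ _ (u (g * h)%g)) !det_u ?groupM // !mulr1 => <-.
have u1 : exists2 w : C, w ^+ d = 1 & u 1%g = w%:M.
  have [w wd] := umul _ _ (group1 G) (group1 G); rewrite mulg1 => u11.
  by exists w => //; apply: unitary_scalar u11; exact: uu.
have UE g : U g = nu g *: u g by rewrite scalerA divff ?scale1r.
clearbody u; have uX g k : g \in G -> exists2 w : C, w ^+ d = 1 & u g ^+ k = w *: u (g ^+ k)%g.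
  move=> gG; elim: k => [|k [w wd IH]].
    case: u1 => w wd u1E; exists w^-1; first by rewrite exprVn wd invr1.
    rewrite expg0 u1E scale_scalar_mx mulVf //.
    by apply: contra_eq_neq wd => ->; rewrite expr0n eq_sym oner_eq0.
  have [w' w'd uuk] := umul g (g ^+ k)%g gG (groupX _ gG).
  exists (w * w'); first by rewrite exprMn wd w'd mulr1.
  rewrite exprS IH; change (u g *m (w *: u (g ^+ k)%g) = (w * w') *: u (g ^+ k.+1)%g).
  by rewrite -scalemxAr uuk scalerA expgS.
(* The power [#|G|] brings [u g] back to a scalar that is a d-th root of unity; the factor [d]
   removes this scalar as well as the cocycle. *)
exists u, (d * #|G|)%N; split=> //.
- by rewrite muln_gt0 cardG_gt0.
- by move=> g; exists (nu g).
- move=> g h gG hG; have [w wd ugh] := umul g h gG hG.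
  by exists w => //; rewrite exprM wd expr1n.
- move=> g gG; have [w wd uk] := uX g #|G| gG; case: u1 => w' w'd u1E.
  rewrite mulnC exprM uk (cyclic.expg_cardG gG) u1E scale_scalar_mx.
  change ((w * w')%:M ^+ d = 1 :> 'M[C]_d).
  by rewrite -rmorphXn exprMn wd w'd mulr1 rmorph1.
Qed.

Variables (gT : finGroupType) (G : {group gT}) (u : gT -> 'M[C]_d) (K : nat).
Hypothesis u_unitary : forall g, g \in G -> u g \is unitarymx.
Hypothesis u_mul : forall g h, g \in G -> h \in G ->
  exists2 w : C, w ^+ K = 1 & u g *m u h = w *: u (g * h)%g.

(** Unnormalized: for n a multiple of [K] it is [#|G|] times the orthogonal projection onto the
    invariant vectors. *)
Definition twirl n : 'M[C]_(d ^ n) := \sum_(g in G) ntensmx (u g) n.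

(** The cocycle enters to the power [K * m], hence is 1, and left multiplication only permutes the
    summands. *)
Lemma mul_twirl m h : h \in G ->
  ntensmx (u h) (K * m) *m twirl (K * m) = twirl (K * m).
Proof.
move=> hG; rewrite mulmx_sumr [RHS](reindex_inj (mulgI h)) /=.
rewrite [RHS](eq_bigl (fun g => g \in G)) => [|g]; last by rewrite groupMl.
apply: eq_bigr => g gG; rewrite -ntensmxM.
by have [w wK ->] := u_mul hG gG; rewrite ntensmxZ exprM wK expr1n scale1r.
Qed.

Lemma dot_twirl m x y :
  dot (twirl (K * m) *m x) (twirl (K * m) *m y) =
  #|G|%:R * dot x (twirl (K * m) *m y).
Proof.
rewrite {1}/twirl mulmx_suml dot_suml.
transitivity (\sum_(g in G) dot x (twirl (K * m) *m y)); last first.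
  by rewrite sumr_const mulr_natl.
apply: eq_bigr => g gG.
rewrite -{1}(mul_twirl m gG) -[_ *m _ *m y]mulmxA dot_unitary //.
exact/ntensmx_unitary/u_unitary.
Qed.

Lemma twirl_eigen (H : 'M[C]_d) n (x : 'cV[C]_(d ^ n)) e :
  (forall g, g \in G -> comm_mx (u g) H) ->
  total_hamiltonian H n *m x = e *: x ->
  total_hamiltonian H n *m (twirl n *m x) = e *: (twirl n *m x).
Proof.
move=> uH Hx; have -> : total_hamiltonian H n *m (twirl n *m x) =
    twirl n *m (total_hamiltonian H n *m x).
  rewrite !mulmxA; congr (_ *m _); apply: comm_mx_sum => g gG.
  exact: esym (total_hamiltonian_comm n (uH g gG)).
by rewrite Hx scalemxAr.
Qed.

(** The vectors [X + z *: Y] are invariant, so the reflections along them are admissible unitaries;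
    the twirl commutes with the total Hamiltonian, so [X] and [Y] keep their energies. *)
Lemma twirl_order (H rho : 'M[C]_d) m (x y : nat -> 'cV[C]_d) (ex ey : nat -> R) :
  is_hermitian H -> is_hermitian rho -> is_psd rho ->
  (forall g, g \in G -> comm_mx (u g) H) ->
  completely_passive_inv G u H rho ->
  (0 < K * m)%N ->
  (forall k, (k < K * m)%N -> H *m x k = (ex k)%:C *: x k) ->
  (forall k, (k < K * m)%N -> H *m y k = (ey k)%:C *: y k) ->
  \sum_(k < K * m) ex k < \sum_(k < K * m) ey k ->
  let S := twirl (K * m) in
  let X := S *m tensv x (K * m) in let Y := S *m tensv y (K * m) in
  let P := ntensmx rho (K * m) in
  dot X X * dot Y (P *m Y) <= dot Y Y * dot X (P *m X) /\
  (X != 0 -> dot X (P *m Y) = 0).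
Proof.
move=> Hh rh rp uH passive n0 Hx Hy exy S X Y P.
apply: (@reflection_passive _ _ P (total_hamiltonian H (K * m)) _ _ _ _
  _ _ _ _ _ exy).
- exact: ntensmx_hermitian.
- exact: total_hamiltonian_hermitian.
- exact: ntensmx_psd.
- apply: twirl_eigen => //; rewrite (total_hamiltonian_eigen Hx).
  by rewrite rmorph_sum.
- apply: twirl_eigen => //; rewrite (total_hamiltonian_eigen Hy).
  by rewrite rmorph_sum.
move=> z v0 /=; have [_ ub] := passive _ n0; rewrite -subr_le0.
apply: ub; exists (householder (X + z *: Y)) => //; split; first exact: householder_unitary.
move=> g gG; apply: householder_comm; first exact/ntensmx_unitary/u_unitary.
by rewrite mulmxDr -scalemxAr !mulmxA mul_twirl.
Qed.

End Twirl.

(** * Asymptotics of twirled product vectors *)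

Lemma prod_periodic (K : comPzSemiRingType) (F : nat -> K) N L :
  \prod_(k < N * L) F (k %% L)%N = (\prod_(k < L) F k) ^+ N.
Proof.
elim: N => [|N IH]; first by rewrite mul0n big_ord0 expr0.
rewrite mulSn big_split_ord /= exprS -IH; congr (_ * _); apply: eq_bigr => k _.
  by rewrite modn_small.
by rewrite modnDl.
Qed.

Lemma sum_periodic (V : nmodType) (F : nat -> V) N L :
  \sum_(k < N * L) F (k %% L)%N = (\sum_(k < L) F k) *+ N.
Proof.
elim: N => [|N IH]; first by rewrite mul0n big_ord0 mulr0n.
rewrite mulSn big_split_ord /= mulrS -IH; congr (_ + _); apply: eq_bigr => k _.
  by rewrite modn_small.
by rewrite modnDl.
Qed.

Section WorkExtraction.

Variables (R : realType) (d' : nat).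
Local Notation d := d'.+1.
Local Notation C := R[i].
Variables (gT : finGroupType) (G : {group gT}) (u : gT -> 'M[C]_d) (K : nat).
Variables H rho : 'M[C]_d.
Hypothesis K_gt0 : (0 < K)%N.
Hypothesis u_unitary : forall g, g \in G -> u g \is unitarymx.
Hypothesis u_mul : forall g h, g \in G -> h \in G ->
  exists2 w : C, w ^+ K = 1 & u g *m u h = w *: u (g * h)%g.
Hypothesis u_exp : forall g, g \in G -> u g ^+ K = 1.
Hypothesis u_comm : forall g, g \in G -> comm_mx (u g) H.
Hypothesis H_herm : is_hermitian H.
Hypothesis rho_herm : is_hermitian rho.
Hypothesis rho_psd : is_psd rho.
Hypothesis passive : completely_passive_inv G u H rho.

Lemma repr1_scalar : exists2 w : C, w ^+ K = 1 & u 1%g = w%:M.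
Proof.
have [w wK] := u_mul (group1 G) (group1 G); rewrite mulg1 => u11.
by exists w => //; apply: unitary_scalar u11; exact: u_unitary.
Qed.

(** The coherence between the twirls of the powers of [a] and [b] expands into a power sum over
    pairs in [G]. All its terms vanish, and the pair [(1, 1)] gives the claim since [u 1] is a
    nonzero scalar. *)
Lemma energy_coherence_eq0 (a b : 'cV[C]_d) (ea eb : R) :
  H *m a = ea%:C *: a -> H *m b = eb%:C *: b -> ea < eb -> dot a (rho *m b) = 0.
Proof.
move=> Ha Hb eab.
pose w (gh : gT * gT) := dot (u gh.1 *m a) (rho *m (u gh.2 *m b)) ^+ K.
have w0 m : (0 < m)%N ->
    \sum_(gh : gT * gT | (gh.1 \in G) && (gh.2 \in G)) w gh ^+ m = 0.
  move=> m0; have n0 : (0 < K * m)%N by rewrite muln_gt0 K_gt0.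
  have [|||_] := twirl_order (x := fun=> a) (y := fun=> b) (ex := fun=> ea)
    (ey := fun=> eb) u_unitary u_mul H_herm rho_herm rho_psd u_comm passive n0.
  - by [].
  - by [].
  - by rewrite !sumr_const card_ord ltrMn2r n0.
  set X := _ *m _; set Y := _ *m _ => XY0.
  have : dot X Y = 0.
    by case: (eqVneq X 0) => [->|X0]; [rewrite dot0l | exact: XY0 X0].
  rewrite /X /Y /twirl !mulmx_suml mulmx_sumr dot_suml => XY.
  rewrite -{}[RHS]XY -(pair_big (mem G) (mem G) (fun g h => w (g, h) ^+ m)) /=.
  apply: eq_bigr => g _; rewrite dot_sumr; apply: eq_bigr => h _.
  by rewrite !ntensmxMv dot_tensv prodr_const card_ord exprM.
have /eqP := power_sums_eq0 w0 (i := (1%g, 1%g)) (introT andP (conj (group1 G) (group1 G))).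
rewrite /w /= expf_eq0 K_gt0 /=; case: repr1_scalar => c cK ->.
rewrite !mul_scalar_mx -scalemxAr dotZl dotZr !mulf_eq0 conjC_eq0.
have c0 : c != 0 by apply: contra_eq_neq cK => ->; rewrite expr0n gtn_eqF // eq_sym oner_eq0.
by rewrite (negPf c0) => /eqP.
Qed.

(** Equality case of Cauchy-Schwarz: if the overlap [c] has modulus 1, then [v] is a [c]-eigenvector
    of [u g], and [u g ^+ K = 1] gives [c ^+ K = 1]. *)
Lemma repr_contraction g (v : 'cV[C]_d) : g \in G -> dot v v = 1 ->
  dot v (u g *m v) ^+ K = 1 \/ `|dot v (u g *m v)| < 1.
Proof.
move=> gG v1; set c := dot v (u g *m v).
have cE : dot (u g *m v - c *: v) (u g *m v - c *: v) = 1 - `|c| ^+ 2.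
  rewrite dotDl dotNl dotZl !dotDr !dotNr !dotZr dot_unitary ?u_unitary // v1.
  by rewrite -/c -(dotC v) -/c normCK; ring.
have c1 : `|c| <= 1.
  by rewrite -(@expr_le1 _ 2) // -subr_ge0 -cE dot_ge0.
have [c1'|] := eqVneq `|c| 1; last by right; rewrite lt_neqAle c1 andbT.
left; have /eqP : dot (u g *m v - c *: v) (u g *m v - c *: v) = 0.
  by rewrite cE c1' expr1n subrr.
rewrite dot_eq0 subr_eq0 => /eqP uv.
have uX k : u g ^+ k *m v = c ^+ k *: v.
  elim: k => [|k IH]; first by rewrite scale1r mul1mx.
  by rewrite exprSr -[_ * _]/(_ *m _) -mulmxA uv -scalemxAr IH scalerA exprS.
by have := congr1 (dot v) (uX K); rewrite u_exp // mul1mx dotZr v1 mulr1 => <-.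
Qed.

Definition expect g (v : 'cV[C]_d) : R :=
  complex.Re (dot (u g *m v) (rho *m (u g *m v))).

Lemma expectE g v : dot (u g *m v) (rho *m (u g *m v)) = (expect g v)%:C.
Proof. by apply: ge0_realC; exact: psd_dot_ge0. Qed.

Lemma expect_ge0 g v : 0 <= expect g v.
Proof. by rewrite -lecR -expectE psd_dot_ge0. Qed.

Let twirl_vec (x : nat -> 'cV[C]_d) n := twirl G u n *m tensv x n.

(** The squared norm is [#|G|] times the power sum of the [z g], each equal to 1 or of modulus below
    1 by [repr_contraction]. *)
Lemma twirl_norm_ge L (x : nat -> 'cV[C]_d) :
  (forall k, (k < L)%N -> dot (x k) (x k) = 1) ->
  exists m0, forall m, (m0 <= m)%N ->
  2^-1 <= dot (twirl_vec (fun k => x (k %% L)%N) (K * (m * L)))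
              (twirl_vec (fun k => x (k %% L)%N) (K * (m * L))).
Proof.
move=> x1; pose z g := (\prod_(k < L) dot (x k) (u g *m x k)) ^+ K.
have z_1 : z 1%g = 1.
  case: repr1_scalar => c cK u1E; rewrite /z u1E.
  under eq_bigr => k _ do rewrite mul_scalar_mx dotZr x1 // mulr1.
  by rewrite prodr_const card_ord exprAC cK expr1n.
have zP g : g \in G -> z g = 1 \/ `|z g| < 1.
  move=> gG; rewrite /z.
  case: (boolP [exists k : 'I_L, `|dot (x k) (u g *m x k)| < 1]) => [/existsP[k k1]|].
    right; rewrite normrX exprn_ilt1 ?gtn_eqF // (bigD1 k) //= normrM.
    apply: le_lt_trans k1; rewrite ler_piMr // normr_prod prodr_ile1 // => j _.
    rewrite normr_ge0 /=; case: (repr_contraction gG (x1 j (ltn_ord j))) => [jK|/ltW//].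
    by rewrite -(@expr_le1 _ K) // -normrX jK normr1.
  rewrite negb_exists => /forallP x_fix; left; rewrite -prodrXl big1 // => k _.
  case: (repr_contraction gG (x1 k (ltn_ord k))) => // k1.
  by have := x_fix k; rewrite k1.
have [m0 m0P] := power_sum_norm_ge (group1 G) z_1 zP.
exists m0 => m /m0P {m0P} le.
rewrite -[leRHS]ger0_norm ?dot_ge0 // /twirl_vec dot_twirl // normrM normr_nat.
apply: le_trans le _; rewrite -[leLHS]mul1r.
rewrite (_ : \sum_(g in G) _ = dot (tensv (fun k => x (k %% L)%N) (K * (m * L)))
  (twirl G u (K * (m * L)) *m tensv (fun k => x (k %% L)%N) (K * (m * L)))).
  by rewrite ler_wpM2r // ler1n cardG_gt0.
rewrite mulmx_suml dot_sumr; apply: eq_bigr => g _.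
rewrite ntensmxMv dot_tensv mulnA.
by rewrite (prod_periodic (fun k => dot (x k) (u g *m x k))) exprM.
Qed.

(** Repeat both blocks [K * m] times and twirl. The ordering of the twirled vectors loses only a
    factor independent of m, which [le_of_powers] removes. *)
Lemma product_order L (x y : nat -> 'cV[C]_d) (ex ey p : nat -> R) :
  (forall k, (k < L)%N -> dot (x k) (x k) = 1) ->
  (forall k, (k < L)%N -> dot (y k) (y k) = 1) ->
  (forall k, (k < L)%N -> H *m x k = (ex k)%:C *: x k) ->
  (forall k, (k < L)%N -> H *m y k = (ey k)%:C *: y k) ->
  (forall k, (k < L)%N -> rho *m y k = (p k)%:C *: y k) ->
  \sum_(k < L) ex k < \sum_(k < L) ey k ->
  exists2 g, g \in G & \prod_(k < L) p k <= \prod_(k < L) expect g (x k).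
Proof.
move=> x1 y1 Hx Hy rhoy exy.
have L0 : (0 < L)%N by case: L exy {x1 y1 Hx Hy rhoy} => //; rewrite !big_ord0 ltxx.
have modL k : (k %% L < L)%N by rewrite ltn_pmod.
have p0 k : (k < L)%N -> 0 <= p k.
  move=> kL; have := psd_dot_ge0 (y k) rho_psd.
  by rewrite rhoy // dotZr y1 // mulr1 lecR.
have [mx mxP] := twirl_norm_ge x1; have [my myP] := twirl_norm_ge y1.
(* The 4 comes from the two squared norms, each at least 1/2; the cube collects [#|G|^2] from
   [lower] and [#|G|] from [upper]. *)
pose c : R := (4 * #|G|%:R ^+ 3)^-1.
have G0 : 0 < #|G|%:R :> C by rewrite ltr0n cardG_gt0.
have c0 : 0 < c by rewrite invr_gt0 mulr_gt0 ?exprn_gt0 ?ltr0n ?cardG_gt0.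
have [|||g gG le] := @le_of_powers _ _ (mem G) (fun g => (\prod_(k < L) expect g (x k)) ^+ K)
  c ((\prod_(k < L) p k) ^+ K) 1%g (maxn 1 (maxn mx my)) (group1 G) _ _ c0.
- by move=> g _; rewrite exprn_ge0 // prodr_ge0 // => k _; exact: expect_ge0.
- by rewrite exprn_ge0 // prodr_ge0 // => k _; exact: p0.
- move=> m; rewrite !geq_max => /and3P[m0 /mxP mX /myP mY].
  move: mX mY => /=; set n := (K * (m * L))%N.
  set x' := fun k => x (k %% L)%N; set y' := fun k => y (k %% L)%N.
  set X := twirl_vec x' n; set Y := twirl_vec y' n => NX NY.
  have n0 : (0 < K * (m * L))%N by rewrite !muln_gt0 K_gt0 m0.
  have [|||XY _] := twirl_order (x := x') (y := y')
    (ex := fun k => ex (k %% L)%N) (ey := fun k => ey (k %% L)%N)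
    u_unitary u_mul H_herm rho_herm rho_psd u_comm passive n0.
  - by move=> k _; exact: Hx.
  - by move=> k _; exact: Hy.
  - by rewrite mulnA !sum_periodic ltrMn2r muln_gt0 K_gt0 m0.
  have {}XY : dot X X * dot Y (ntensmx rho n *m Y) <=
      dot Y Y * dot X (ntensmx rho n *m X) by exact: XY.
  set T := (\prod_(k < L) p k) ^+ K ^+ m.
  (* Keep only the component of [Y] along the eigenvector [tensv y' n] of the tensor power of
     [rho]. *)
  have lower : T%:C * (dot Y Y / #|G|%:R) ^+ 2 <= dot Y (ntensmx rho n *m Y).
    have y'1 : dot (tensv y' n) (tensv y' n) = 1.
      by rewrite dot_tensv big1 // => k _; exact: y1.
    have rhoy' : ntensmx rho n *m tensv y' n = T%:C *: tensv y' n.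
      rewrite ntensmxMv (@eq_tensv _ _ _ (fun k => (p (k %% L)%N)%:C *: y' k)).
        rewrite tensvZ -rmorph_prod /n mulnA prod_periodic exprM.
        by [].
      by move=> k _; exact: rhoy.
    have := psd_eigen_le Y (ntensmx_hermitian n rho_herm) (ntensmx_psd rho_herm rho_psd)
      y'1 rhoy'.
    have -> : dot (tensv y' n) Y = dot Y Y / #|G|%:R.
      rewrite /Y /twirl_vec dot_twirl // mulrC mulKf // gt_eqF //.
    by rewrite ger0_norm // divr_ge0 ?dot_ge0 // ltW.
  (* [psd_sum_le] replaces the form at the sum over [G] by the sum of the forms. *)
  have upper : dot X (ntensmx rho n *m X) <=
      #|G|%:R * (\sum_(g in G) (\prod_(k < L) expect g (x k)) ^+ K ^+ m)%:C.
    rewrite /X /twirl_vec /twirl mulmx_suml.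
    apply: le_trans (psd_sum_le _ _ (ntensmx_hermitian n rho_herm)
      (ntensmx_psd rho_herm rho_psd)) _.
    rewrite le_eqVlt; apply/orP; left; apply/eqP; congr (_ * _).
    rewrite rmorph_sum; apply: eq_bigr => g _.
    rewrite !ntensmxMv dot_tensv; under eq_bigr do rewrite expectE.
    rewrite -rmorph_prod /n mulnA.
    by rewrite (prod_periodic (fun k => expect g (x k))) exprM.
  move: upper; set F := \sum_(g in G) _ => upper.
  have half0 : 0 < 2^-1 :> C by rewrite invr_gt0 ltr0n.
  have NX0 := lt_le_trans half0 NX; have NY0 := lt_le_trans half0 NY.
  have T0 : 0 <= T%:C :> C.
    by rewrite lecR !exprn_ge0 // prodr_ge0 // => k _; exact: p0.
  have {lower upper}XY : dot X X * (T%:C * (dot Y Y / #|G|%:R) ^+ 2) <=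
      dot Y Y * (#|G|%:R * F%:C).
    apply: le_trans (ler_wpM2l (ltW NX0) lower) _.
    by apply: le_trans XY _; rewrite ler_pM2l.
  have {}XY : dot X X * dot Y Y * T%:C <= #|G|%:R ^+ 3 * F%:C.
    have e : 0 < #|G|%:R ^+ 2 / dot Y Y by rewrite divr_gt0 // exprn_gt0.
    have := ler_wpM2l (ltW e) XY; congr (_ <= _); field.
      by rewrite !gt_eqF.
    by rewrite gt_eqF.
  have {}XY : 2^-1 * 2^-1 * T%:C <= #|G|%:R ^+ 3 * F%:C :> C.
    by apply: le_trans XY; rewrite (ler_wpM2r T0) // ler_pM // ltW.
  rewrite -lecR rmorphM /c fmorphV rmorphM rmorphXn !rmorph_nat.
  have := ler_wpM2l (ltW (_ : 0 < (#|G|%:R ^+ 3)^-1 :> C)) XY.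
  rewrite invr_gt0 exprn_gt0 // => /(_ isT).
  rewrite [X in _ <= X](_ : _ = F%:C); last by field; rewrite gt_eqF.
  by congr (_ <= _); field; rewrite gt_eqF.
exists g => //; move: le; rewrite ler_pXn2r ?nnegrE ?prodr_ge0 // => k _.
  exact: p0.
exact: expect_ge0.
Qed.

End WorkExtraction.

(** * Energy levels *)

Section Levels.

Variables (R : realType) (n : nat) (Q : 'M[R[i]]_n).
Local Notation C := R[i].
Hypothesis Q_unitary : Q \is unitarymx.

Lemma mx_eq0_basis (M : 'M[C]_n) :
  (forall i j, dot (col i Q) (M *m col j Q) = 0) -> M = 0.
Proof.
move=> M0; have QMQ : adjmx Q *m (M *m Q) = 0.
  apply/matrixP => i j; rewrite [RHS]mxE -(M0 i j) mxE dotE.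
  apply: eq_bigr => k _; rewrite !mxE; congr (_ * _).
  by apply: eq_bigr => l _; rewrite !mxE.
rewrite -[M]mulmx1 -(unitarymxE Q_unitary) -[M]mul1mx -(unitarymxE Q_unitary).
by rewrite -!mulmxA (mulmxA M) (mulmxA (adjmx Q)) QMQ mul0mx mulmx0.
Qed.

Lemma sdiag_commP (V : 'M[C]_n) (h : 'I_n -> R) :
  comm_mx V (sdiag Q h) <->
  forall i j, h i != h j -> dot (col i Q) (V *m col j Q) = 0.
Proof.
have E i j : dot (col i Q) ((V *m sdiag Q h - sdiag Q h *m V) *m col j Q) =
    ((h j)%:C - (h i)%:C) * dot (col i Q) (V *m col j Q).
  rewrite mulmxBl dotDr dotNr -(mulmxA V) -(mulmxA (sdiag Q h)) sdiag_col //.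
  rewrite -scalemxAr dotZr.
  rewrite -(hermitian_dot _ _ (sdiag_hermitian Q h)) sdiag_col // dotZl conj_realC.
  by rewrite mulrBl.
split=> [Vh i j hij|Vh].
  have /esym/eqP := E i j; rewrite Vh subrr mul0mx dot0r mulf_eq0 -rmorphB.
  by rewrite (inj_eq (@complexI _) _ 0) subr_eq0 eq_sym (negPf hij) => /eqP.
apply/eqP; rewrite -subr_eq0; apply/eqP/mx_eq0_basis => i j; rewrite E.
by have [->|/Vh ->] := eqVneq (h i) (h j); rewrite ?subrr ?mul0r ?mulr0.
Qed.

(** Applying [f] can only merge eigenvalues, which leaves fewer entries that must vanish. *)
Lemma sdiag_comm_comp (V : 'M[C]_n) (h : 'I_n -> R) (f : R -> R) :
  comm_mx V (sdiag Q h) -> comm_mx V (sdiag Q (f \o h)).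
Proof.
move/sdiag_commP => Vh; apply/sdiag_commP => i j fij; apply: Vh.
by apply: contra_neq fij => /= ->.
Qed.

Variables h p : 'I_n -> R.

Lemma level_maxP : exists top : 'I_n -> 'I_n, forall i,
  h (top i) = h i /\ forall j, h j = h i -> p j <= p (top i).
Proof.
exists (fun i => [arg max_(j > i | h j == h i) p j]%O) => i.
case: arg_maxP => [//|j /eqP hj jmax]; split=> // k hk.
by apply: jmax; apply/eqP.
Qed.

Lemma level_coord_eq0 (v : 'cV[C]_n) e i :
  sdiag Q h *m v = e%:C *: v -> h i != e -> dot (col i Q) v = 0.
Proof.
move=> hv hi; have := hermitian_dot (col i Q) v (sdiag_hermitian Q h).
rewrite sdiag_col // hv dotZl dotZr conj_realC => /eqP.
rewrite -subr_eq0 -mulrBl -rmorphB mulf_eq0 (inj_eq (@complexI _) _ 0).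
by rewrite subr_eq0 (negPf hi) => /eqP.
Qed.

(** A vector of level [e] has no components elsewhere, so the expectation of [t - rho] is a sum of
    nonnegative terms. If it is not positive, every term vanishes and [v] lies in the kernel. *)
Lemma level_gap (v : 'cV[C]_n) e (t : R) :
  sdiag Q h *m v = e%:C *: v -> (forall i, h i = e -> p i <= t) ->
  dot v (sdiag Q p *m v) <= t%:C * dot v v /\
  (t%:C * dot v v <= dot v (sdiag Q p *m v) ->
   sdiag Q (fun i => t - p i) *m v = 0).
Proof.
move=> hv pt; set N := sdiag Q (fun i => t - p i).
have NE : dot v (N *m v) = t%:C * dot v v - dot v (sdiag Q p *m v).
  have -> : N = t%:C *: 1%:M - sdiag Q p.
    have pN : - sdiag Q p = sdiag Q (fun i => -1 * p i).
      by rewrite -sdiagZ rmorphN rmorph1 scaleN1r.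
    rewrite pN -(sdiag1 Q_unitary) sdiagZ sdiagD; apply: eq_sdiag => i /=.
    by rewrite mulr1 mulN1r.
  by rewrite mulmxBl -scalemxAl mul1mx dotDr dotNr dotZr.
have N0 i : 0 <= (t - p i)%:C * `|dot (col i Q) v| ^+ 2.
  have [/pt ti|hi] := eqVneq (h i) e.
    by rewrite mulr_ge0 ?exprn_ge0 // lecR subr_ge0.
  by rewrite (level_coord_eq0 hv hi) normr0 expr0n mulr0.
split; first by rewrite -subr_ge0 -NE dot_sdiag sumr_ge0.
rewrite -subr_le0 -NE => Nle; apply/eqP; rewrite -dot_eq0 dotMl.
rewrite (sdiag_hermitian Q) mulmxA sdiagM // dot_sdiag.
have /eqP : \sum_i (t - p i)%:C * `|dot (col i Q) v| ^+ 2 = 0.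
  by apply/eqP; rewrite eq_le -dot_sdiag Nle dot_sdiag sumr_ge0.
rewrite psumr_eq0 // => /allP N_eq0; apply/eqP/big1 => i _.
by rewrite rmorphM -mulrA (eqP (N_eq0 i (mem_index_enum _))) mulr0.
Qed.

End Levels.

(** Archimedean argument: take m large and n the integer part of [m x / y]; the hypothesis at [n.+1]
    contradicts a positive defect [a y - x b]. *)
Lemma le_of_ratios (R : realType) (x y a b : R) :
  0 <= x -> 0 < y -> 0 <= b ->
  (forall m n : nat, m%:R * x < n%:R * y -> m%:R * a <= n%:R * b) ->
  a * y <= x * b.
Proof.
move=> x0 y0 b0 le; rewrite -subr_le0; set e := a * y - x * b.
rewrite leNgt; apply/negP => e0.
have [m me] : exists m : nat, y * b / e < m%:R.
  exists (Num.truncn (y * b / e)).+1; apply: truncnS_gt.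
have [n [nx xn]] : exists n : nat, n%:R * y <= m%:R * x /\ m%:R * x < n.+1%:R * y.
  exists (Num.truncn (m%:R * x / y)).
  have xy0 : 0 <= m%:R * x / y by rewrite divr_ge0 ?mulr_ge0 // ltW.
  rewrite -ler_pdivlMr // -ltr_pdivrMr //; split; last exact: truncnS_gt.
  by rewrite truncn_le.
have := ler_wpM2r (ltW y0) (le _ _ xn).
have := ler_wpM2r b0 nx.
move: me; rewrite ltr_pdivrMr // -[n.+1]addn1 natrD /e; nra.
Qed.

(** * Classification *)

Section Classification.

Variables (R : realType) (d' : nat).
Local Notation d := d'.+1.
Local Notation C := R[i].
Variables (gT : finGroupType) (G : {group gT}) (u : gT -> 'M[C]_d) (K : nat).
Variables H rho : 'M[C]_d.
Hypothesis K_gt0 : (0 < K)%N.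
Hypothesis u_unitary : forall g, g \in G -> u g \is unitarymx.
Hypothesis u_mul : forall g h, g \in G -> h \in G ->
  exists2 w : C, w ^+ K = 1 & u g *m u h = w *: u (g * h)%g.
Hypothesis u_exp : forall g, g \in G -> u g ^+ K = 1.
Hypothesis u_comm : forall g, g \in G -> comm_mx (u g) H.
Hypothesis H_herm : is_hermitian H.
Hypothesis rho_herm : is_hermitian rho.
Hypothesis rho_psd : is_psd rho.
Hypothesis passive : completely_passive_inv G u H rho.

Lemma passive_comm : comm_mx rho H.
Proof.
case: (joint_spectral H_herm H_herm erefl) => Q [h [_ [Qu HE _]]].
rewrite HE; apply/sdiag_commP => // i j.
have Hcol k : H *m col k Q = (h k)%:C *: col k Q by rewrite HE sdiag_col.
rewrite neq_lt => /orP[hij|hji].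
  exact: (energy_coherence_eq0 K_gt0 u_unitary u_mul u_comm H_herm rho_herm rho_psd
    passive (Hcol i) (Hcol j) hij).
rewrite -(hermitian_dot _ _ rho_herm) -dotC.
rewrite (energy_coherence_eq0 K_gt0 u_unitary u_mul u_comm H_herm rho_herm rho_psd
    passive (Hcol j) (Hcol i) hji).
exact: conjC0.
Qed.

Variables (Q : 'M[C]_d) (h p : 'I_d -> R) (top : 'I_d -> 'I_d).
Hypothesis Q_unitary : Q \is unitarymx.
Hypothesis HE : H = sdiag Q h.
Hypothesis rhoE : rho = sdiag Q p.
Hypothesis topP : forall i, h (top i) = h i /\ forall j, h j = h i -> p j <= p (top i).

(** The largest eigenvalue of [rho] in the energy level of [i]; it depends on [h i] only. *)
Local Notation t i := (p (top i)).

Lemma expect_le g (v : 'cV[C]_d) i :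
  g \in G -> dot v v = 1 -> H *m v = (h i)%:C *: v -> expect u rho g v <= t i.
Proof.
move=> gG v1 Hv; have Huv : sdiag Q h *m (u g *m v) = (h i)%:C *: (u g *m v).
  by rewrite -HE mulmxA -(u_comm gG) -mulmxA Hv scalemxAr.
have [le _] := level_gap Q_unitary Huv (topP i).2.
move: le; rewrite -rhoE (expectE u rho_psd) dot_unitary ?u_unitary // v1 mulr1.
by rewrite lecR.
Qed.

Lemma p_ge0 i : 0 <= p i.
Proof. by apply: (sdiag_state_ge0 i Q_unitary); rewrite -rhoE. Qed.

(** Apply [product_order] to m copies of [a] with n top vectors of [s], against m top vectors of [k]
    with n of [r]. On the level of [s], [expect_le] removes the dependence on [g]. *)
Lemma block_order (a : 'cV[C]_d) ea (m n : nat) (k r s : 'I_d) :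
  dot a a = 1 -> H *m a = ea%:C *: a ->
  m%:R * ea + n%:R * h s < m%:R * h k + n%:R * h r ->
  exists2 g, g \in G & t k ^+ m * t r ^+ n <= expect u rho g a ^+ m * t s ^+ n.
Proof.
move=> a1 Ha lt_e.
have split_sum (V : nmodType) (x y : V) :
    \sum_(q < m + n) (if (q < m)%N then x else y) = x *+ m + y *+ n.
  rewrite big_split_ord /=; congr (_ + _).
    by rewrite -[in RHS](card_ord m) -sumr_const; apply: eq_bigr => q _; rewrite ltn_ord.
  rewrite -[in RHS](card_ord n) -sumr_const; apply: eq_bigr => q _.
  by rewrite ltnNge leq_addr.
have split_prod (x y : R) :
    \prod_(q < m + n) (if (q < m)%N then x else y) = x ^+ m * y ^+ n.
  rewrite big_split_ord /=; congr (_ * _).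
    by rewrite -[in RHS](card_ord m) -prodr_const; apply: eq_bigr => q _; rewrite ltn_ord.
  rewrite -[in RHS](card_ord n) -prodr_const; apply: eq_bigr => q _.
  by rewrite ltnNge leq_addr.
have col1 i : dot (col i Q) (col i Q) = 1 by rewrite dot_col // eqxx.
have Hcol i : H *m col (top i) Q = (h i)%:C *: col (top i) Q.
  by rewrite HE sdiag_col // (topP i).1.
have rcol i : rho *m col i Q = (p i)%:C *: col i Q by rewrite rhoE sdiag_col.
have [||||||g gG le] := product_order (L := (m + n)%N) K_gt0 u_unitary u_mul u_exp u_comm
  H_herm rho_herm rho_psd passive
  (x := fun q => if (q < m)%N then a else col (top s) Q)
  (y := fun q => if (q < m)%N then col (top k) Q else col (top r) Q)
  (ex := fun q => if (q < m)%N then ea else h s)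
  (ey := fun q => if (q < m)%N then h k else h r)
  (p := fun q => if (q < m)%N then t k else t r).
- by move=> q _; case: ifP => _; [exact: a1 | exact: col1].
- by move=> q _; case: ifP => _; exact: col1.
- by move=> q _; case: ifP => _; [exact: Ha | exact: Hcol].
- by move=> q _; case: ifP => _; exact: Hcol.
- by move=> q _; case: ifP => _; exact: rcol.
- by rewrite !split_sum -(mulr_natl ea) -(mulr_natl (h s)) -(mulr_natl (h k)) -(mulr_natl (h r)).
exists g => //; rewrite -split_prod; apply: le_trans le _.
rewrite (eq_bigr (fun q : 'I_(m + n) => if (q < m)%N then expect u rho g a else
  expect u rho g (col (top s) Q))) => [|q _]; last by case: ifP.
rewrite split_prod ler_wpM2l ?exprn_ge0 ?expect_ge0 //.
rewrite lerXn2r ?nnegrE ?expect_ge0 ?p_ge0 //.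
exact: expect_le.
Qed.

Lemma level_order (m n : nat) (k j i0 : 'I_d) :
  m%:R * h k + n%:R * h i0 < m%:R * h i0 + n%:R * h j ->
  t i0 ^+ m * t j ^+ n <= t k ^+ m * t i0 ^+ n.
Proof.
have top1 : dot (col (top k) Q) (col (top k) Q) = 1 by rewrite dot_col // eqxx.
have Htop : H *m col (top k) Q = (h k)%:C *: col (top k) Q.
  by rewrite HE sdiag_col // (topP k).1.
case/(block_order top1 Htop) => g gG le; apply: le_trans le _.
rewrite ler_wpM2r ?exprn_ge0 ?p_ge0 // lerXn2r ?nnegrE ?expect_ge0 ?p_ge0 //.
exact: expect_le.
Qed.

Lemma level_antitone (s r : 'I_d) : h s < h r -> t r <= t s.
Proof.
move=> hsr; have := @level_order 0 1 s r s; rewrite !expr0 !mul1r !expr1.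
by apply; lra.
Qed.

(* Every energy eigenvector reaches the maximal expectation [t k] somewhere on
   its orbit, so one of the finitely many kernels of [(t k - rho) u_g] contains
   the whole eigenspace. *)
Lemma level_scalar (s r k : 'I_d) : h s < h r -> 0 < t r -> 0 < t k -> p k = t k.
Proof.
move=> hsr tr0 tk0; have ts0 : 0 < t s.
  exact: lt_le_trans tr0 (level_antitone hsr).
pose N := sdiag Q (fun i => t k - p i).
(* Projection onto the level of [k]; composing with it lets [union_kernels] test arbitrary
   vectors. *)
pose P := sdiag Q (fun i => (h i == h k)%:R).
have HP : sdiag Q h *m P = (h k)%:C *: P.
  rewrite /P (sdiagM _ _ Q_unitary) sdiagZ; apply: eq_sdiag => i.
  by case: (eqVneq (h i) (h k)) => [->|_] /=; rewrite ?mulr0n // !mulr0.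
have [|g gG NuP] := @union_kernels C gT (mem G) d d (fun g => N *m u g *m P).
  move=> v; pose w := P *m v.
  have Hw : H *m w = (h k)%:C *: w.
    by rewrite HE /w (mulmxA (sdiag Q h)) HP scalemxAl.
  have [w0|w0] := eqVneq w 0.
    by exists 1%g; [exact: group1 | rewrite /= -(mulmxA _ P) -/w w0 mulmx0].
  have ww0 : 0 < dot w w by rewrite dot_gt0.
  pose a := (sqrtC (dot w w))^-1 *: w.
  have s0 : 0 < sqrtC (dot w w) by rewrite sqrtC_gt0.
  have a1 : dot a a = 1.
    have sC : (sqrtC (dot w w))^* = sqrtC (dot w w) by exact/CrealP/ger0_real/ltW.
    rewrite dotZl dotZr fmorphV /= sC mulrA -invfM.
    by rewrite -expr2 sqrtCK mulVf // gt_eqF.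
  have Ha : H *m a = (h k)%:C *: a.
    by rewrite -scalemxAr Hw !scalerA mulrC.
  (* The m repeated sites have equal energies on both sides; one extra site with [h s < h r] makes
     the inequality strict for every m and costs only the constant [t r / t s]. *)
  have [|m _|g gG le] := @le_of_powers R gT (mem G) (fun g => expect u rho g a)
      (t r / t s) (t k) 1%g 0 (group1 G) _ (ltW tk0) (divr_gt0 tr0 ts0).
  - by move=> g _; exact: expect_ge0.
  - have [|g gG le] := @block_order a (h k) m 1 k r s a1 Ha.
      by rewrite !mul1r ltrD2l.
    apply: le_trans (_ : expect u rho g a ^+ m <= _).
      by rewrite mulrAC ler_pdivrMr // mulrC; move: le; rewrite !expr1.
    rewrite (bigD1 g) //= lerDl sumr_ge0 // => g' _.
    by rewrite exprn_ge0 // expect_ge0.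
  exists g => //.
  have Hua : sdiag Q h *m (u g *m a) = (h k)%:C *: (u g *m a).
    by rewrite -HE mulmxA -(u_comm gG) -mulmxA Ha scalemxAr.
  have [_ Na] := level_gap Q_unitary Hua (topP k).2.
  have {}Na : N *m (u g *m a) = 0.
    apply: Na; rewrite -rhoE (expectE u rho_psd) dot_unitary ?u_unitary // a1 mulr1.
    by rewrite lecR.
  have -> : N *m u g *m P *m v = sqrtC (dot w w) *: (N *m (u g *m a)).
    rewrite -(mulmxA _ P) -/w -(mulmxA N) -!scalemxAr scalerA divff ?scale1r //.
    by rewrite gt_eqF.
  by rewrite Na scaler0.
have uP : comm_mx (u g) P.
  apply: (sdiag_comm_comp Q_unitary (fun x => (x == h k)%:R)).
  by rewrite -HE; exact: u_comm.
(* [u g] commutes with the projection and is invertible, so it cancels. *)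
have NP : N *m P = 0.
  move: NuP; rewrite -(mulmxA N) uP (mulmxA N) => /(congr1 (mulmx^~ (adjmx (u g)))).
  by rewrite mul0mx -(mulmxA _ (u g)) (unitarymxE (u_unitary gG)) mulmx1.
have := congr1 (fun M : 'M[C]_d => dot (col k Q) (M *m col k Q)) NP.
rewrite /N /P (sdiagM _ _ Q_unitary) (sdiag_col _ _ Q_unitary) mul0mx dot0r dotZr dot_col // !eqxx mulr1.
rewrite mulr1 => /eqP; rewrite (inj_eq (@complexI _) _ 0) subr_eq0 => /eqP.
by [].
Qed.

Lemma passive_classification : \tr rho = 1 ->
  is_ground_state H rho \/ exists beta : R, 0 <= beta /\ rho = gibbs_state H beta.
Proof.
move=> tr1; have [i0 i0_min] : exists i0, forall i, h i0 <= h i.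
  exists [arg min_(j < ord0) h j]%O; case: arg_minP => // i _ imin j.
  exact: imin.
(* Either all weight lies in the lowest level, or some populated excited level [j] serves as
   reference. *)
case: (boolP [forall j, (h i0 < h j) ==> (t j == 0)]) => [/forallP t0|].
  left; split; first by split.
  exists (h i0)%:C; split.
  - by rewrite HE; apply/eigenvalue_sdiag => //; exists i0.
  - by move=> e'; rewrite HE => /(eigenvalue_sdiag _ _ Q_unitary)[i ->]; rewrite lecR.
  apply/eigenspaceP; rewrite rhoE HE sdiagM // sdiagZ; apply: eq_sdiag => i.
  have := i0_min i; rewrite le_eqVlt => /orP[/eqP->|hi]; first by rewrite mulrC.
  suff -> : p i = 0 by rewrite mul0r mulr0.
  apply/eqP; rewrite eq_le p_ge0 andbT.
  by have /implyP/(_ hi)/eqP <- := t0 i; apply: (topP i).2.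
rewrite negb_forall => /existsP[j]; rewrite negb_imply => /andP[hj tj0].
have {}tj0 : 0 < t j by rewrite lt0r tj0 p_ge0.
have t0_gt0 : 0 < t i0 by apply: lt_le_trans tj0 (level_antitone hj).
pose e k := h k - h i0.
have e_ge0 k : 0 <= e k by rewrite subr_ge0.
have ej0 : 0 < e j by rewrite subr_gt0.
have order m n k l : m%:R * e k < n%:R * e l ->
    t i0 ^+ m * t l ^+ n <= t k ^+ m * t i0 ^+ n.
  by move=> le; apply: level_order; move: le; rewrite /e !mulrBr; lra.
(* Enough copies of [j] cost more energy than one copy of [k], so [order] keeps [t k] away from
   0. *)
have t_gt0 k : 0 < t k.
  pose n := (Num.truncn (e k / e j)).+1.
  have le : 1%:R * e k < n%:R * e j.
    by rewrite mul1r -ltr_pdivrMr // truncnS_gt.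
  have := order _ _ _ _ le; rewrite !expr1 => {}le.
  have := lt_le_trans (mulr_gt0 t0_gt0 (exprn_gt0 n tj0)) le.
  by rewrite pmulr_lgt0 // exprn_gt0.
(* In terms of this logarithmic deficit the Gibbs form is [l k = beta * e k]. *)
pose l k := ln (t i0) - ln (t k).
have l_order m n k k' : m%:R * e k < n%:R * e k' -> m%:R * l k <= n%:R * l k'.
  move=> /order; rewrite -ler_ln ?posrE ?mulr_gt0 ?exprn_gt0 //.
  rewrite !lnM ?posrE ?exprn_gt0 // !lnXn // -!(mulr_natl (ln _)).
  by rewrite /l !mulrBr; lra.
have l_ge0 k : 0 < e k -> 0 <= l k.
  by rewrite subr_gt0 => /level_antitone tk; rewrite subr_ge0 ler_ln ?posrE.
have l_eq0 k : e k = 0 -> l k = 0.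
  move/eqP; rewrite subr_eq0 => /eqP hk; apply/eqP; rewrite subr_eq0; apply/eqP; congr ln.
  apply/eqP; rewrite eq_le; apply/andP; split.
    by apply: (topP k).2; rewrite (topP i0).1.
  by apply: (topP i0).2; rewrite (topP k).1.
have l_affine k : l k * e j = e k * l j.
  have [ek0|ek0] := eqVneq (e k) 0; first by rewrite ek0 l_eq0 // !mul0r.
  have {}ek0 : 0 < e k by rewrite lt0r ek0 e_ge0.
  apply/eqP; rewrite eq_le; apply/andP; split.
    by apply: le_of_ratios => // [|m n]; [exact: l_ge0 | exact: l_order].
  rewrite mulrC [leRHS]mulrC.
  by apply: le_of_ratios => // [|m n]; [exact: l_ge0 | exact: l_order].
pose beta := l j / e j.
right; exists beta; split; first by rewrite divr_ge0 // ?l_ge0 // ltW.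
have pE i : p i = t i0 * expR (beta * h i0) * expR (- beta * h i).
  rewrite (level_scalar hj tj0 (t_gt0 i)) -[t i]lnK ?posrE //.
  rewrite -[X in X * _ * _]lnK ?posrE // -!expRD; congr expR.
  have -> : ln (t i) = ln (t i0) - l i by rewrite /l subKr.
  have -> : l i = beta * e i by rewrite /beta mulrAC -[l j * _]mulrC -l_affine mulfK ?gt_eqF.
  by rewrite /e; ring.
have rE : rho = sdiag Q (fun i => t i0 * expR (beta * h i0) * expR (- beta * h i)).
  by rewrite rhoE; exact: eq_sdiag.
rewrite rE HE (gibbs_sdiag _ _ Q_unitary); apply: eq_sdiag => i; congr (_ * _).
(* Unit trace identifies the prefactor with the inverse partition function. *)
move: tr1; rewrite rE tr_sdiag // -mulr_sumr => /(@complexI _ _ 1) c1.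
apply: (mulIf (x := \sum_i expR (- beta * h i))).
  rewrite gt_eqF // (bigD1 ord0) //= ltr_pwDl ?expR_gt0 //.
  by rewrite sumr_ge0 // => k _; exact: expR_ge0.
rewrite c1 mulVf // gt_eqF // (bigD1 ord0) //= ltr_pwDl ?expR_gt0 //.
by rewrite sumr_ge0 // => k _; exact: expR_ge0.
Qed.

End Classification.

(** * Change of representation and of the set of unitaries; the equivalences *)

Lemma completely_passive_inv_scale (R : realType) (gT : finGroupType)
    (G : {group gT}) (d' : nat) (U u : gT -> 'M[R[i]]_d'.+1) (H rho : 'M[R[i]]_d'.+1) :
  (forall g, exists2 c : R[i], c != 0 & U g = c *: u g) ->
  completely_passive_inv G U H rho -> completely_passive_inv G u H rho.
Proof.
move=> Uu passive n n0; have [_ ub] := passive n n0; split.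
  exists 1%:M; last by rewrite /extracted_work adjmx1 mul1mx mulmx1 subrr.
  split; first by apply/unitarymxP; rewrite -[X in _ *m X]/(adjmx _) adjmx1 mulmx1.
  by move=> g _; exact: comm1mx.
move=> _ [V [Vu Vg] <-]; apply: ub; exists V => //; split=> // g gG.
have [c _ ->] := Uu g; rewrite ntensmxZ /comm_mx -scalemxAr -scalemxAl; congr (_ *: _); exact: Vg.
Qed.

(** Restricting to invariant unitaries keeps the upper bound 0, and the identity, which is
    invariant, still attains it. *)
Lemma completely_passive_weaken (R : realType) (gT : finGroupType)
    (G : {group gT}) (d : nat) (U : gT -> 'M[R[i]]_d) (H rho : 'M[R[i]]_d) :
  completely_passive H rho -> completely_passive_inv G U H rho.
Proof.
move=> passive n n0; have [_ ub] := passive n n0; split.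
  exists 1%:M; last by rewrite /extracted_work adjmx1 mul1mx mulmx1 subrr.
  split; first by apply/unitarymxP; rewrite -[X in _ *m X]/(adjmx _) adjmx1 mulmx1.
  by move=> g _; exact: comm1mx.
by move=> _ [V [Vu _] <-]; apply: ub; exists V.
Qed.

Theorem corollary3 (R : realType) (gT : finGroupType) (G : {group gT})
    (d : nat) (U : gT -> 'M[R[i]]_d) (H rho : 'M[R[i]]_d)
    (U_repr : is_projective_unitary_repr G U)
    (H_herm : is_hermitian H)
    (H_inv : forall g, g \in G -> comm_mx (U g) H)
    (rho_state : is_state rho) :
  (completely_passive_inv G U H rho <-> completely_passive H rho) /\
  (completely_passive H rho <->
     is_ground_state H rho \/
     exists beta : R, 0 <= beta /\ rho = gibbs_state H beta).
Proof.
case: rho_state => rho_herm rho_psd tr1.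
case: d => [|d'] in U H rho U_repr H_herm H_inv rho_herm rho_psd tr1 *.
  (* In dimension 0 the trace is an empty sum and cannot be 1. *)
  by move/eqP: tr1; rewrite /mxtrace big_ord0 eq_sym oner_eq0.
have sufficient : is_ground_state H rho \/
    (exists beta : R, 0 <= beta /\ rho = gibbs_state H beta) -> completely_passive H rho.
  case=> [|[beta [beta0 ->]]]; first exact: ground_completely_passive.
  exact: gibbs_completely_passive.
have necessary : completely_passive_inv G U H rho -> is_ground_state H rho \/
    exists beta : R, 0 <= beta /\ rho = gibbs_state H beta.
  have [u [K [K0 uu Uu umul uexp]]] := projective_repr_normalize U_repr.
  move=> /(completely_passive_inv_scale Uu) passive.
  have ucomm g : g \in G -> comm_mx (u g) H.
    move=> gG; have [c c0 UE] := Uu g; have -> : u g = c^-1 *: U g.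
      by rewrite UE scalerA mulVf ?scale1r.
    by rewrite /comm_mx -scalemxAl -scalemxAr (H_inv g gG).
  have rhoH := passive_comm K0 uu umul ucomm H_herm rho_herm rho_psd passive.
  have [Q [p [h [Qu rE HE]]]] := joint_spectral rho_herm H_herm rhoH.
  have [top topP] := level_maxP h p.
  exact: (passive_classification K0 uu umul uexp ucomm H_herm rho_herm rho_psd passive
    Qu HE rE topP tr1).
split; split.
- by move=> /necessary/sufficient.
- exact: completely_passive_weaken.
- by move=> passive; apply/necessary/completely_passive_weaken.
- exact: sufficient.
Qed.
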